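(* Let $(\mathfrak{A},* )$ be a $*$-algebra. Then $(\mathfrak{A},* )$ is polarizable if and only if there is a $*$-isomorphism $$\phi:\bigoplus_{j=1}^N (M_{n_j}(\mathbb{D}_j),* )\to(\mathfrak{A},* ),$$ where the left-hand side is the $*$-direct sum of a finite number of matrix algebras over real division algebras $\mathbb{D}_j\in\{\mathbb{R},\mathbb{C},\mathbb{H}\}$, each endowed with the conjugate-transpose involution. In this case the polarization constant of $(\mathfrak{A},* )$ is $$\phi\left(\frac{n_1\delta_1}{(n_1-1)\delta_1+2}I_{n_1},\dots,\frac{n_j\delta_j}{(n_j-1)\delta_j+2}I_{n_j},\dots,\frac{n_N\delta_N}{(n_N-1)\delta_N+2}I_{n_N}\right),$$ where $\delta_j=\dim_{\mathbb{R}}(\mathbb{D}_j)\in\{1,2,4\}$ and $I_{n_j}$ is the $n_j\times n_j$ identity matrix of $M_{n_j}(\mathbb{D}_j)$, for $1\le j\le N$.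
   Context: A $*$-algebra $(\mathfrak{A},* )$ is a finite-dimensional unital associative algebra over $\mathbb{R}$ equipped with an $\mathbb{R}$-linear map (involution) $\alpha\mapsto\alpha^*$ satisfying $(\alpha\beta)^*=\beta^*\alpha^*$ and $(\alpha^* )^*=\alpha$. It carries its natural topology as a finite-dimensional real vector space. A $*$-isomorphism is an isomorphism of unital real algebras that intertwines the involutions. The $*$-direct sum of $*$-algebras $(\mathfrak{A}_j,*_j)$ is the direct sum algebra with involution $(\alpha_1,\dots,\alpha_N)^*=(\alpha_1^{*_1},\dots,\alpha_N^{*_N})$. The conjugate-transpose involution on $M_n(\mathbb{D})$ is $A\mapsto(\overline{A})^T$, where $z\mapsto\overline{z}$ is the identity on $\mathbb{R}$, complex conjugation on $\mathbb{C}$, and quaternionic conjugation $a+ib+jc+kd\mapsto a-ib-jc-kd$ on $\mathbb{H}$, applied entrywise. The unitary group is $\Gamma(\mathfrak{A},* )=\{u\in\mathfrak{A}: uu^*=1_{\mathfrak{A}}\}$. A closed subgroup $G\subset\Gamma(\mathfrak{A},* )$ generates $\mathfrak{A}$ if $\mathfrak{A}$ is the smallest $*$-subalgebra of $\mathfrak{A}$ containing $G$ (equivalently, $\mathrm{span}_{\mathbb{R}}G=\mathfrak{A}$). $(\mathfrak{A},* )$ is polarizable if $\Gamma(\mathfrak{A},* )$ is compact and generates $\mathfrak{A}$. A compact subgroup $G\subset\Gamma(\mathfrak{A},* )$ is polarizing if it generates $\mathfrak{A}$ and $\int_G g\,dg=0$ (normalized Haar measure; vector-valued integrals are defined coordinatewise).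 A Hermitian form on a left $\mathfrak{A}$-module $\mathsf{X}$ is a map $Q:\mathsf{X}\times\mathsf{X}\to\mathfrak{A}$ that is additive and left $\mathfrak{A}$-linear in the first argument and satisfies $Q(x,y)^*=Q(y,x)$. The polarization constant of a polarizable $*$-algebra $(\mathfrak{A},* )$ is the element $\kappa=\kappa(\mathfrak{A},* )\in\mathfrak{A}$ such that $Q(x,y)=\kappa\int_G Q(x+gy,x+gy)\,g\,dg$ for every left $\mathfrak{A}$-module $\mathsf{X}$, every Hermitian form $Q$ on $\mathsf{X}$, every polarizing subgroup $G\subset\Gamma(\mathfrak{A},* )$ and all $x,y\in\mathsf{X}$; such an element exists. *)

(* Defs.v *)
From HB Require Import structures.
From mathcomp Require Import all_boot all_order all_algebra.
From mathcomp Require Import complex ring.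
From mathcomp Require Import all_classical all_reals all_analysis.

Set Implicit Arguments.
Unset Strict Implicit.
Unset Printing Implicit Defensive.

Import Order.TTheory GRing.Theory Num.Theory.
Import numFieldNormedType.Exports.
Import VectorInternalTheory.

Local Open Scope classical_set_scope.
Local Open Scope ring_scope.

(* The library's algType and falgType require 1 != 0 and there is no structure
   joining pzRingType and lmodType, so the algebra axioms are spelled out over
   PzRing: the zero algebra is a *-algebra too.  The lmodType and vectType
   structures of a *-algebra are derived below. *)
HB.mixin Record isStarAlgebra (R : fieldType) A of GRing.PzRing A := {
  sascale : R -> A -> A;
  sascaleA : forall k l x, sascale k (sascale l x) = sascale (k * l) x;
  sascale1 : left_id 1 sascale;
  sascaleDr : right_distributive sascale +%R;
  sascaleDl : forall x, {morph sascale^~ x : k l / k + l};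
  sascaleAl : forall k (x y : A), sascale k (x * y) = sascale k x * y;
  sascaleAr : forall k (x y : A), sascale k (x * y) = x * sascale k y;
  sadim : nat;
  sacoord : A -> 'rV[R]_sadim;
  sacoord_linear : forall k x y,
    sacoord (sascale k x + y) = k *: sacoord x + sacoord y;
  sacoord_bij : bijective sacoord;
  star : A -> A;
  star_linear_subproof : forall k x y,
    star (sascale k x + y) = sascale k (star x) + star y;
  starM : forall x y : A, star (x * y) = star y * star x;
  starK : involutive star
}.

#[short(type="starAlgType")]
HB.structure Definition StarAlgebra (R : fieldType) :=
  {A of GRing.PzRing A & isStarAlgebra R A}.

Section StarAlgebraVector.
Variables (R : fieldType) (A : starAlgType R).

HB.instance Definition _ := GRing.Zmodule_isLmodule.Build R (StarAlgebra.sort A)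
  (@sascaleA R A) (@sascale1 R A) (@sascaleDr R A) (@sascaleDl R A).

Fact sacoord_vect_iso : Vector.axiom (@sadim R A) (StarAlgebra.sort A).
Proof. by exists sacoord; [exact: sacoord_linear | exact: sacoord_bij]. Qed.
HB.instance Definition _ :=
  Lmodule_hasFinDim.Build R (StarAlgebra.sort A) sacoord_vect_iso.

Fact star_is_linear : linear (@star R A).
Proof. exact: star_linear_subproof. Qed.
HB.instance Definition _ :=
  GRing.isLinear.Build R A A *:%R (@star R A) star_is_linear.

Lemma stalgAl (k : R) (x y : A) : k *: (x * y) = (k *: x) * y.
Proof. exact: sascaleAl. Qed.
Lemma stalgAr (k : R) (x y : A) : k *: (x * y) = x * (k *: y).
Proof. exact: sascaleAr. Qed.
End StarAlgebraVector.

HB.factory Record Vector_isStarAlgebra (R : fieldType) A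
    of GRing.PzRing A & Vector R A := {
  scale_mulAl : forall (k : R) (x y : A), k *: (x * y) = (k *: x) * y;
  scale_mulAr : forall (k : R) (x y : A), k *: (x * y) = x * (k *: y);
  invol : A -> A;
  invol_linear : linear invol;
  involM : forall x y : A, invol (x * y) = invol y * invol x;
  involK : involutive invol
}.

HB.builders Context (R : fieldType) A of Vector_isStarAlgebra R A.
Fact v2r_lin (k : R) (x y : A) : v2r (k *: x + y) = k *: v2r x + v2r y.
Proof. exact: linearP. Qed.
HB.instance Definition _ := isStarAlgebra.Build R A
  (@scalerA R A) (@scale1r R A) (@scalerDr R A) (fun x k l => @scalerDl R A x k l)
  scale_mulAl scale_mulAr v2r_lin (Bijective v2rK r2vK)
  invol_linear involM involK.
HB.end.

Section Reals.
Variable R : fieldType.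

Definition rstar (x : R^o) : R^o := x.
Fact rstar_scalAr (k : R) (x y : R^o) : k *: (x * y) = x * (k *: y).
Proof. by rewrite /GRing.scale /= mulrCA. Qed.
Fact rstar_scalAl (k : R) (x y : R^o) : k *: (x * y) = (k *: x) * y.
Proof. by rewrite /GRing.scale /= mulrA. Qed.
Fact rstarM (x y : R^o) : rstar (x * y) = rstar y * rstar x.
Proof. by rewrite mulrC. Qed.
HB.instance Definition _ := Vector_isStarAlgebra.Build R R^o
  rstar_scalAl rstar_scalAr (fun _ _ _ => erefl) rstarM (fun _ => erefl).
End Reals.

Section Complexes.
Variable R : rcfType.

Fact cplx_vect_iso : Vector.axiom 2 (Rcomplex R).
Proof.
exists (fun z : Rcomplex R => \row_(i < 2) [:: complex.Re z; complex.Im z]`_i).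
  by move=> k [a b] [c d]; apply/rowP => i; rewrite !mxE; case: i => [[|[|]]].
exists (fun v : 'rV[R]_2 => (v 0 0 +i* v 0 1)%C : Rcomplex R).
  by move=> [a b]; rewrite !mxE.
by move=> v; apply/rowP => i; rewrite mxE; case: i => [[|[|i]]] //= h;
   congr (v _ _); apply/val_inj.
Qed.
HB.instance Definition _ := Lmodule_hasFinDim.Build R (Rcomplex R) cplx_vect_iso.

Definition cstar (z : Rcomplex R) : Rcomplex R := conjc z.
Fact cstar_linear : linear cstar.
Proof. by move=> k [a b] [c d]; congr Complex => /=; ring. Qed.
Fact cstarM x y : cstar (x * y) = cstar y * cstar x.
Proof. by rewrite mulrC /cstar rmorphM. Qed.
Fact cstar_scalAl (k : R) (x y : Rcomplex R) : k *: (x * y) = (k *: x) * y.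
Proof. by rewrite scalerAl. Qed.
Fact cstar_scalAr (k : R) (x y : Rcomplex R) : k *: (x * y) = x * (k *: y).
Proof. by rewrite mulrC scalerAl mulrC. Qed.
HB.instance Definition _ := Vector_isStarAlgebra.Build R (Rcomplex R)
  cstar_scalAl cstar_scalAr cstar_linear cstarM (@conjcK R).
End Complexes.

(* Quat a b c d is the quaternion a + ib + jc + kd. *)
Record quat (R : Type) := Quat { qre : R; qi : R; qj : R; qk : R }.

Section Quaternions.
Variable R : fieldType.
Notation H := (quat R).

Definition quat_tuple (x : H) := (qre x, qi x, qj x, qk x).
Definition tuple_quat (t : R * R * R * R) : H :=
  let: (a, b, c, d) := t in Quat a b c d.
Fact quat_tupleK : cancel quat_tuple tuple_quat. Proof. by case. Qed.
HB.instance Definition _ := Choice.copy H (can_type quat_tupleK).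

Definition addq (x y : H) :=
  Quat (qre x + qre y) (qi x + qi y) (qj x + qj y) (qk x + qk y).
Definition oppq (x : H) := Quat (- qre x) (- qi x) (- qj x) (- qk x).
Definition mulq (x y : H) :=
  let: Quat a b c d := x in let: Quat a' b' c' d' := y in
  Quat (a * a' - b * b' - c * c' - d * d')
       (a * b' + b * a' + c * d' - d * c')
       (a * c' - b * d' + c * a' + d * b')
       (a * d' + b * c' - c * b' + d * a').
Definition scaleq (k : R) (x : H) :=
  Quat (k * qre x) (k * qi x) (k * qj x) (k * qk x).
Definition conjq (x : H) := Quat (qre x) (- qi x) (- qj x) (- qk x).

Fact addqA : associative addq.
Proof. by move=> [????] [????] [????]; congr Quat => /=; ring. Qed.
Fact addqC : commutative addq.
Proof. by move=> [????] [????]; congr Quat => /=; ring. Qed.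
Fact add0q : left_id (Quat 0 0 0 0) addq.
Proof. by move=> [????]; congr Quat => /=; ring. Qed.
Fact addNq : left_inverse (Quat 0 0 0 0) oppq addq.
Proof. by move=> [????]; congr Quat => /=; ring. Qed.
Fact mulqA : associative mulq.
Proof. by move=> [????] [????] [????]; congr Quat => /=; ring. Qed.
Fact mul1q : left_id (Quat 1 0 0 0) mulq.
Proof. by move=> [????]; congr Quat => /=; ring. Qed.
Fact mulq1 : right_id (Quat 1 0 0 0) mulq.
Proof. by move=> [????]; congr Quat => /=; ring. Qed.
Fact mulqDl : left_distributive mulq addq.
Proof. by move=> [????] [????] [????]; congr Quat => /=; ring. Qed.
Fact mulqDr : right_distributive mulq addq.
Proof. by move=> [????] [????] [????]; congr Quat => /=; ring. Qed.
HB.instance Definition _ := GRing.isPzRing.Build H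
  addqA addqC add0q addNq mulqA mul1q mulq1 mulqDl mulqDr.

Fact scaleqA k l (x : H) : scaleq k (scaleq l x) = scaleq (k * l) x.
Proof. by case: x => *; congr Quat => /=; ring. Qed.
Fact scale1q : left_id 1 scaleq.
Proof. by move=> [????]; congr Quat => /=; ring. Qed.
Fact scaleqDr : right_distributive scaleq +%R.
Proof. by move=> k [????] [????]; congr Quat => /=; ring. Qed.
Fact scaleqDl (x : H) : {morph scaleq^~ x : k l / k + l}.
Proof. by case: x => * k l; congr Quat => /=; ring. Qed.
HB.instance Definition _ := GRing.Zmodule_isLmodule.Build R H
  scaleqA scale1q scaleqDr scaleqDl.

Fact quat_vect_iso : Vector.axiom 4 H.
Proof.
exists (fun x : H => \row_(i < 4) [:: qre x; qi x; qj x; qk x]`_i).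
  by move=> k [????] [????]; apply/rowP => i;
     rewrite !mxE; case: i => [[|[|[|[|]]]]].
exists (fun v : 'rV[R]_4 =>
  Quat (v 0 (@Ordinal 4 0 isT)) (v 0 (@Ordinal 4 1 isT))
       (v 0 (@Ordinal 4 2 isT)) (v 0 (@Ordinal 4 3 isT))).
  by move=> [????]; rewrite !mxE.
by move=> v; apply/rowP => i; rewrite mxE; case: i => [[|[|[|[|i]]]]] //= h;
   congr (v _ _); apply/val_inj.
Qed.
HB.instance Definition _ := Lmodule_hasFinDim.Build R H quat_vect_iso.

Fact scaleqAl (k : R) (x y : H) : k *: (x * y) = (k *: x) * y.
Proof. by case: x y => [????] [????]; congr Quat => /=; ring. Qed.
Fact scaleqAr (k : R) (x y : H) : k *: (x * y) = x * (k *: y).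
Proof. by case: x y => [????] [????]; congr Quat => /=; ring. Qed.
Fact conjq_linear : linear conjq.
Proof. by move=> k [????] [????]; congr Quat => /=; ring. Qed.
Fact conjqM (x y : H) : conjq (x * y) = conjq y * conjq x.
Proof. by case: x y => [????] [????]; congr Quat => /=; ring. Qed.
Fact conjqK : involutive conjq.
Proof. by move=> [????]; congr Quat => /=; ring. Qed.
HB.instance Definition _ := Vector_isStarAlgebra.Build R H
  scaleqAl scaleqAr conjq_linear conjqM conjqK.
End Quaternions.

Inductive divalg_kind := RealD | ComplexD | QuaternionD.

Definition divalg (R : rcfType) (k : divalg_kind) : starAlgType R :=
  match k with
  | RealD => R^o
  | ComplexD => Rcomplex R
  | QuaternionD => quat R
  end.

(* 'M[D]_n carries the scaling by D; the alias starmx carries the entrywise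
   scaling by the base field. *)
Definition starmx (R : fieldType) (D : starAlgType R) (n : nat) := 'M[D]_n.

Section StarMatrix.
Variables (R : fieldType) (D : starAlgType R) (n : nat).
Notation M := (starmx D n).

HB.instance Definition _ := GRing.PzRing.on M.

Definition scale_starmx (k : R) (x : M) : M := map_mx ( *:%R k) x.
Definition star_starmx (x : M) : M := (map_mx star x)^T.

Fact scale_starmxA k l x :
  scale_starmx k (scale_starmx l x) = scale_starmx (k * l) x.
Proof. by apply/matrixP => i j; rewrite !mxE scalerA. Qed.
Fact scale1_starmx : left_id 1 scale_starmx.
Proof. by move=> x; apply/matrixP => i j; rewrite !mxE scale1r. Qed.
Fact scale_starmxDr : right_distributive scale_starmx +%R.
Proof. by move=> k x y; apply/matrixP => i j; rewrite !mxE scalerDr. Qed.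
Fact scale_starmxDl x : {morph scale_starmx^~ x : k l / k + l}.
Proof. by move=> k l; apply/matrixP => i j; rewrite !mxE scalerDl. Qed.
HB.instance Definition _ := GRing.Zmodule_isLmodule.Build R M
  scale_starmxA scale1_starmx scale_starmxDr scale_starmxDl.

Fact starmx_vect_iso : Vector.axiom (#|{: 'I_n * 'I_n}| * dim D) M.
Proof.
pose fr (x : M) := mxvec (\matrix_(p < #|{: 'I_n * 'I_n}|)
  v2r (x (enum_val p).1 (enum_val p).2)).
exists fr.
  move=> k x y; rewrite /fr -linearP; congr mxvec.
  by apply/matrixP => i j; rewrite !mxE linearP !mxE.
exists (fun r => \matrix_(i, j) r2v (row (enum_rank (i, j)) (vec_mx r)) : M).
  by move=> x; apply/matrixP => i j; rewrite mxE mxvecK rowK v2rK enum_rankK.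
move=> r; apply/(canLR vec_mxK)/matrixP => i j.
by rewrite !mxE r2vK -surjective_pairing enum_valK !mxE.
Qed.
HB.instance Definition _ := Lmodule_hasFinDim.Build R M starmx_vect_iso.

Fact scale_starmxAl (k : R) (x y : M) : k *: (x * y) = (k *: x) * y.
Proof.
apply/matrixP => i j; rewrite !mxE scaler_sumr.
by apply: eq_bigr => l _; rewrite !mxE stalgAl.
Qed.
Fact scale_starmxAr (k : R) (x y : M) : k *: (x * y) = x * (k *: y).
Proof.
apply/matrixP => i j; rewrite !mxE scaler_sumr.
by apply: eq_bigr => l _; rewrite !mxE stalgAr.
Qed.
Fact star_starmx_linear : linear star_starmx.
Proof. by move=> k x y; apply/matrixP => i j; rewrite !mxE linearP. Qed.
Fact star_starmxM (x y : M) :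
  star_starmx (x * y) = star_starmx y * star_starmx x.
Proof.
apply/matrixP => i j; rewrite !mxE linear_sum.
by apply: eq_bigr => l _; rewrite !mxE /= starM.
Qed.
Fact star_starmxK : involutive star_starmx.
Proof. by move=> x; apply/matrixP => i j; rewrite !mxE starK. Qed.
HB.instance Definition _ := Vector_isStarAlgebra.Build R M
  scale_starmxAl scale_starmxAr star_starmx_linear star_starmxM star_starmxK.
End StarMatrix.

Definition stardsum (R : fieldType) (N : nat) (B : 'I_N -> starAlgType R) :=
  {dffun forall j : 'I_N, B j}.

Section StarDirectSum.
Variables (R : fieldType) (N : nat) (B : 'I_N -> starAlgType R).
Notation S := (stardsum B).

Definition mkdsum (f : forall j, B j) : S := @finfun _ (fun j => B j) f.
Fact mkdsumE f j : mkdsum f j = f j. Proof. exact: ffunE. Qed.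
Fact dsumP (x y : S) : (forall j, x j = y j) -> x = y.
Proof. by move=> h; apply/ffunP. Qed.

HB.instance Definition _ := Choice.on S.

Definition add_dsum (x y : S) : S := mkdsum (fun j => x j + y j).
Definition opp_dsum (x : S) : S := mkdsum (fun j => - x j).
Definition mul_dsum (x y : S) : S := mkdsum (fun j => x j * y j).
Definition scale_dsum (k : R) (x : S) : S := mkdsum (fun j => k *: x j).
Definition star_dsum (x : S) : S := mkdsum (fun j => star (x j)).

Fact add_dsumA : associative add_dsum.
Proof. by move=> x y z; apply: dsumP => j; rewrite !mkdsumE addrA. Qed.
Fact add_dsumC : commutative add_dsum.
Proof. by move=> x y; apply: dsumP => j; rewrite !mkdsumE addrC. Qed.
Fact add_dsum0 : left_id (mkdsum (fun=> 0)) add_dsum.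
Proof. by move=> x; apply: dsumP => j; rewrite !mkdsumE add0r. Qed.
Fact add_dsumN : left_inverse (mkdsum (fun=> 0)) opp_dsum add_dsum.
Proof. by move=> x; apply: dsumP => j; rewrite !mkdsumE addNr. Qed.
Fact mul_dsumA : associative mul_dsum.
Proof. by move=> x y z; apply: dsumP => j; rewrite !mkdsumE mulrA. Qed.
Fact mul1_dsum : left_id (mkdsum (fun=> 1)) mul_dsum.
Proof. by move=> x; apply: dsumP => j; rewrite !mkdsumE mul1r. Qed.
Fact mul_dsum1 : right_id (mkdsum (fun=> 1)) mul_dsum.
Proof. by move=> x; apply: dsumP => j; rewrite !mkdsumE mulr1. Qed.
Fact mul_dsumDl : left_distributive mul_dsum add_dsum.
Proof. by move=> x y z; apply: dsumP => j; rewrite !mkdsumE mulrDl. Qed.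
Fact mul_dsumDr : right_distributive mul_dsum add_dsum.
Proof. by move=> x y z; apply: dsumP => j; rewrite !mkdsumE mulrDr. Qed.
HB.instance Definition _ := GRing.isPzRing.Build S
  add_dsumA add_dsumC add_dsum0 add_dsumN
  mul_dsumA mul1_dsum mul_dsum1 mul_dsumDl mul_dsumDr.

Fact scale_dsumA k l x : scale_dsum k (scale_dsum l x) = scale_dsum (k * l) x.
Proof. by apply: dsumP => j; rewrite !mkdsumE scalerA. Qed.
Fact scale1_dsum : left_id 1 scale_dsum.
Proof. by move=> x; apply: dsumP => j; rewrite !mkdsumE scale1r. Qed.
Fact scale_dsumDr : right_distributive scale_dsum +%R.
Proof. by move=> k x y; apply: dsumP => j; rewrite !mkdsumE scalerDr. Qed.
Fact scale_dsumDl x : {morph scale_dsum^~ x : k l / k + l}.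
Proof. by move=> k l; apply: dsumP => j; rewrite !mkdsumE scalerDl. Qed.
HB.instance Definition _ := GRing.Zmodule_isLmodule.Build R S
  scale_dsumA scale1_dsum scale_dsumDr scale_dsumDl.

Fact dsum_vect_iso : Vector.axiom (\sum_j dim (B j))%N S.
Proof.
exists (fun x : S => \mxrow_j v2r (x j)).
  move=> k x y; apply/matrixP => i l; rewrite !mxE.
  have -> : (k *: x + y) (tagnat.sig1 l) = k *: x (tagnat.sig1 l) + y (tagnat.sig1 l).
    by rewrite !mkdsumE.
  by rewrite linearP !mxE.
exists (fun v => mkdsum (fun j => r2v (submxrow v j))).
  by move=> x; apply: dsumP => j; rewrite mkdsumE mxrowK v2rK.
by move=> v; apply/mxrowP => j; rewrite mxrowK mkdsumE r2vK.
Qed.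
HB.instance Definition _ := Lmodule_hasFinDim.Build R S dsum_vect_iso.

Fact scale_dsumAl (k : R) (x y : S) : k *: (x * y) = (k *: x) * y.
Proof. by apply: dsumP => j; rewrite !mkdsumE stalgAl. Qed.
Fact scale_dsumAr (k : R) (x y : S) : k *: (x * y) = x * (k *: y).
Proof. by apply: dsumP => j; rewrite !mkdsumE stalgAr. Qed.
Fact star_dsum_linear : linear star_dsum.
Proof. by move=> k x y; apply: dsumP => j; rewrite !mkdsumE linearP. Qed.
Fact star_dsumM (x y : S) : star_dsum (x * y) = star_dsum y * star_dsum x.
Proof. by apply: dsumP => j; rewrite !mkdsumE starM. Qed.
Fact star_dsumK : involutive star_dsum.
Proof. by move=> x; apply: dsumP => j; rewrite !mkdsumE starK. Qed.
HB.instance Definition _ := Vector_isStarAlgebra.Build R S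
  scale_dsumAl scale_dsumAr star_dsum_linear star_dsumM star_dsumK.
End StarDirectSum.

Definition star_isomorphism (R : fieldType) (A B : starAlgType R)
    (phi : A -> B) : Prop :=
  [/\ linear phi,
      phi 1 = 1,
      {morph phi : x y / x * y},
      {morph phi : x / star x} &
      bijective phi].

(* [natural A] is A with its natural topology, transported from R^(dim A) along the library's
   linear bijection v2r; any other linear bijection gives the same one. *)
Definition natural (R : realType) (A : starAlgType R) : Type :=
  initial_topology (v2r : A -> 'rV[R]_(dim A)).

HB.instance Definition _ (R : realType) (A : starAlgType R) :=
  Topological.on (natural A).
HB.instance Definition _ (R : realType) (A : starAlgType R) :=
  isPointed.Build (natural A) (0 : A).

Definition borel (R : realType) (A : starAlgType R) :=
  g_sigma_algebraType (@open (natural A)).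

Section Polarization.
Variables (R : realType) (A : starAlgType R).

Definition unitary_group : set A := [set u | u * star u = 1].

Definition star_subalgebra (B : set A) : Prop :=
  [/\ B 1,
      forall (k : R) x y, B x -> B y -> B (k *: x + y),
      forall x y, B x -> B y -> B (x * y) &
      forall x, B x -> B (star x)].

Definition generates (G : set A) : Prop :=
  forall B : set A, star_subalgebra B -> G `<=` B -> B = [set: A].

(* The inverse of a unitary element u is star u. *)
Definition unitary_subgroup (G : set A) : Prop :=
  [/\ G `<=` unitary_group,
      G 1,
      forall u v, G u -> G v -> G (u * v) &
      forall u, G u -> G (star u)].

Definition polarizable : Prop :=
  compact (unitary_group : set (natural A)) /\ generates unitary_group.

(* The normalized Haar measure of a compact G, seen as a Borel probability
   measure on A carried by G. *)
Definition is_haar (G : set A) (mu : probability (borel A) R) : Prop :=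
  mu G = 1%E /\
  forall g (E : set (borel A)), G g -> measurable E -> E `<=` G ->
    mu [set g * x | x in (E : set A)] = mu E.

(* Coordinatewise integral. The integrands below are continuous on the compact
   set G, so all the coordinates are integrable. *)
Definition vintegral (mu : probability (borel A) R) (G : set A)
    (f : A -> A) : A :=
  r2v (\row_i \int[mu]_(g in (G : set (borel A))) v2r (f g) 0 i).

(* The Haar measure of a compact group exists and is unique. The existential
   here and the universal quantification in [is_polarization_constant] both
   refer to that measure. *)
Definition polarizing (G : set A) : Prop :=
  [/\ unitary_subgroup G,
      compact (G : set (natural A)),
      generates G &
      exists2 mu, is_haar G mu & vintegral mu G id = 0].

Definition hermitian_form (X : lmodType A) (Q : X -> X -> A) : Prop :=
  [/\ forall x1 x2 y, Q (x1 + x2) y = Q x1 y + Q x2 y,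
      forall (a : A) x y, Q (a *: x) y = a * Q x y &
      forall x y, star (Q x y) = Q y x].

Definition is_polarization_constant (kappa : A) : Prop :=
  forall (X : lmodType A) (Q : X -> X -> A) (G : set A)
         (mu : probability (borel A) R),
    hermitian_form Q -> polarizing G -> is_haar G mu ->
    forall x y : X,
      Q x y = kappa * vintegral mu G
                        (fun g => Q (x + g *: y) (x + g *: y) * g).
End Polarization.

Arguments polarizable {R} A.

Definition matrix_sum (R : realType) (N : nat) (D : 'I_N -> divalg_kind)
    (n : 'I_N -> nat) : starAlgType R :=
  stardsum (fun j => starmx (divalg R (D j)) (n j) : starAlgType R).

Definition polarization_element (R : realType) (N : nat)
    (D : 'I_N -> divalg_kind) (n : 'I_N -> nat) : matrix_sum R D n :=
  mkdsum (fun j =>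
    let delta := (\dim {: divalg R (D j)})%:R : R in
    let nj := (n j)%:R : R in
    (nj * delta / ((nj - 1) * delta + 2)) *:
      (1%:M : starmx (divalg R (D j)) (n j))).

Lemma dim_divalg (R : rcfType) (k : divalg_kind) :
  \dim {: divalg R k} =
    match k with RealD => 1 | ComplexD => 2 | QuaternionD => 4 end.
Proof. by rewrite dimvf; case: k. Qed.

(* Main.v *)
From HB Require Import structures.
Require Import Defs.
From mathcomp Require Import all_boot all_order all_algebra.
From mathcomp Require Import perm complex ring lra.
From mathcomp Require Import all_classical all_reals all_analysis.

Set Implicit Arguments.
Unset Strict Implicit.
Unset Printing Implicit Defensive.

Import Order.TTheory GRing.Theory Num.Theory.
Import numFieldNormedType.Exports.
Import VectorInternalTheory.

Local Open Scope classical_set_scope.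
Local Open Scope ring_scope.

(** Suppose that the unitary group is compact and spans. Transporting an inner
    product by the unitary elements gives a bounded family of forms, and
    minimising a uniformly convex orbit norm on a convex set of positive
    definite forms produces an invariant inner product [B]
    ([bounded_group_fixed_point], [invariant_form]). Invariance under a
    spanning set of unitary elements means that [star] is the adjoint, so [tau
    a := B a 1] satisfies [0 < tau (star a * a)] for every nonzero [a]
    ([positive_functional_exists]).

    Such a functional forces Wedderburn's theorem together with the
    involution. A hermitian element has real eigenvalues and is not nilpotent,
    so a corner [e A e] with a hermitian element that is not scalar contains a
    smaller projection ([split_projection]). In a minimal corner the hermitian
    elements are scalar, and the argument of Frobenius identifies it with the
    reals, the complex numbers or the quaternions ([corner_frobenius]). A
    maximal family [u_1], ..., [u_n] in the left ideal [A e] with [star u_i *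
    u_j = delta_ij e] gives matrix units [u_i * star u_j], and [u_1 * star u_1
    + ... + u_n * star u_n] is central by maximality ([block_exists]).
    Splitting off such summands exhausts the algebra ([positive_structure]).
    Conversely, the coordinates of a unitary element of a sum of matrix
    algebras are bounded by one, and a finite group of monomial matrices
    generates the sum ([unitary_compact], [monomial_group_generates]).

    For the constant, let [T a] be the integral of [g * a * g] over a
    polarizing group. Invariance gives [T a = star a * T 1] ([sandwichE]).
    Over the standard orthonormal basis [E_i] of a summand, [E_i * g * E_i]
    sums to [(2 - delta) star g] and [E_i * star E_i] sums to [n * delta], so
    [T 1] acts on that summand as [(2 - delta) / (n * delta)]
    ([sandwich_unit]). Expanding [Q (x + g y) (x + g y) * g] and using that
    the mean of [g] vanishes leaves [Q x y * (1 + T 1)]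
    ([polarization_integral]), and [1 + T 1] is the inverse of the stated
    central element ([polarization_elementV]). It is the only constant,
    because a polarizing group exists: the finite monomial group with its
    counting measure ([polarizing_exists], [polarization_constant_unique]). *)

(** * Projections and orthogonal families *)

Section StarBasics.
Variables (R : fieldType) (A : starAlgType R).
Implicit Types (a b x y : A) (k : R).

Lemma star1 : star (1 : A) = 1.
Proof.
by rewrite -[RHS](starK 1) -[in RHS](mul1r (star 1)) starM starK mul1r.
Qed.

Definition projection (e : A) := star e = e /\ e * e = e.

Lemma projection1 : projection (1 : A).
Proof. by split; rewrite ?star1 ?mulr1. Qed.

Lemma projectionB (e p : A) : projection e -> projection p -> e * p = p ->
  projection (e - p).
Proof.
move=> [se ee] [sp pp] ep.
have pe : p * e = p by rewrite -sp -[in LHS]se -starM ep.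
by split; rewrite ?linearB /= ?se ?sp // mulrBr !mulrBl ee ep pe pp subrr subr0.
Qed.

(** Left multiplication by [star x] isolates the coefficient of [x] in a linear
    relation, provided that [star x * x] is nonzero. *)
Lemma orthogonal_size (s : seq A) :
  (forall x, x \in s -> star x * x != 0) ->
  pairwise (fun x y => star x * y == 0) s -> (size s <= dim A)%N.
Proof.
move=> nz orth.
have : free s.
  elim: s nz orth => [|x s IH] nz /=; first by rewrite nil_free.
  move=> /andP [/allP xs orth]; rewrite free_cons IH // ?andbT; last first.
    by move=> y ys; apply: nz; rewrite inE ys orbT.
  apply/negP; rewrite -[s]in_tupleE => /coord_span xE.
  have := nz x (mem_head _ _); rewrite {2}xE mulr_sumr big1 ?eqxx // => i _.
  by rewrite -stalgAr (eqP (xs _ (mem_nth _ _))) ?scaler0 //= ltn_ord.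
by move=> /eqP <-; rewrite -dimvf dimvS // subvf.
Qed.

End StarBasics.

(** * Polynomials in an element of a corner *)

Section CornerPolynomials.
Variables (R : rcfType) (A : starAlgType R) (e h : A).

(** The factor [e] makes the constant polynomial 1 take the value [e], the unit
    of the corner. *)
Definition corner_eval (P : {poly R}) : A :=
  \sum_(i < size P) P`_i *: (h ^+ i * e).

Lemma corner_evalE n (P : {poly R}) : (size P <= n)%N ->
  corner_eval P = \sum_(i < n) P`_i *: (h ^+ i * e).
Proof.
move=> Pn; rewrite /corner_eval (big_ord_widen n (fun i => P`_i *:
  (h ^+ i * e))) //.
rewrite big_mkcond /=; apply: eq_bigr => i _.
by case: ltnP => // Pi; rewrite nth_default ?scale0r.
Qed.

Lemma corner_eval_linear : linear corner_eval.
Proof.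
move=> k P Q; pose n := maxn (size P) (size Q).
have sP : (size P <= n)%N by rewrite leq_maxl.
have sQ : (size Q <= n)%N by rewrite leq_maxr.
have sPQ : (size (k *: P + Q)%R <= n)%N.
  apply: leq_trans (size_polyD _ _) _; rewrite geq_max sQ andbT.
  exact: leq_trans (size_scale_leq _ _) sP.
rewrite (corner_evalE sP) (corner_evalE sQ) (corner_evalE sPQ) scaler_sumr.
rewrite -big_split; apply: eq_bigr => i _ /=.
by rewrite coefD coefZ scalerDl scalerA.
Qed.
HB.instance Definition _ :=
  GRing.isLinear.Build R {poly R} A *:%R corner_eval corner_eval_linear.

Lemma corner_eval1 : corner_eval 1 = e.
Proof.
by rewrite (@corner_evalE 1) ?size_poly1 // big_ord1 coefC eqxx expr0 mul1r
  scale1r.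
Qed.

Lemma corner_evalXM P : corner_eval ('X * P) = h * corner_eval P.
Proof.
rewrite (@corner_evalE (size P).+1); last first.
  by apply: leq_trans (size_polyMleq _ _) _; rewrite size_polyX.
rewrite big_ord_recl coefXM eqxx scale0r add0r mulr_sumr; apply: eq_bigr => i _.
by rewrite coefXM /= exprS -mulrA -!stalgAr.
Qed.

Hypothesis he : h * e = h.
Hypothesis eh : e * h = h.
Hypothesis ee : e * e = e.

Lemma corner_pow i : e * (h ^+ i * e) = h ^+ i * e.
Proof.
by case: i => [|i]; rewrite ?expr0 ?mul1r // exprS !mulrA eh.
Qed.

Lemma corner_evalMe P : e * corner_eval P = corner_eval P.
Proof.
rewrite mulr_sumr; apply: eq_bigr => i _.
by rewrite -stalgAr corner_pow.
Qed.

Lemma corner_eval_eigen a (k : A) P : e * k = k -> h * k = a *: k ->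
  corner_eval P * k = P.[a] *: k.
Proof.
move=> ek hk; have hik i : h ^+ i * k = a ^+ i *: k.
  elim: i => [|i IH]; first by rewrite !expr0 mul1r scale1r.
  by rewrite exprS -mulrA IH -stalgAr hk scalerA -exprSr.
rewrite horner_coef scaler_suml mulr_suml; apply: eq_bigr => i _.
by rewrite -stalgAl -mulrA ek hik scalerA.
Qed.

Lemma corner_eval_star P : star h = h -> star e = e ->
  star (corner_eval P) = corner_eval P.
Proof.
move=> sh se; rewrite linear_sum; apply: eq_bigr => i _ /=.
rewrite linearZ /= starM se; congr (_ *: _).
have com : e * h = h * e by rewrite he eh.
elim: (i : nat) => [|j IH]; first by rewrite !expr0 star1 mulr1 mul1r.
by rewrite [in LHS]exprSr starM sh mulrA com -(mulrA h e) IH mulrA -exprS.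
Qed.

(** The first [dim A + 1] powers of [h] are linearly dependent. *)
Lemma corner_annihilator : exists2 P : {poly R}, P != 0 & corner_eval P = 0.
Proof.
pose M := \matrix_(i < (dim A).+1) v2r (h ^+ i * e).
have /rowV0Pn [c /sub_kermxP cM c0] : kermx M != 0.
  rewrite kermx_eq0 /row_free neq_ltn; apply/orP; left.
  by rewrite ltnS rank_leq_col.
exists (\poly_(i < (dim A).+1) c 0 (inord i)).
  apply: contraNneq c0 => /polyP P0; apply/eqP/rowP => i.
  by have := P0 i; rewrite coef_poly ltn_ord inord_val coef0 mxE.
rewrite (corner_evalE (size_poly _ _)); apply: (can_inj v2rK); rewrite !linear0.
rewrite -[RHS]cM mulmx_sum_row linear_sum; apply: eq_bigr => i _.
by rewrite coef_poly ltn_ord inord_val linearZ rowK.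
Qed.

End CornerPolynomials.

(** The factor [X - a] comes from a real root, and the quadratic one, positive
    on the reals, from a pair of conjugate roots. *)
Lemma poly_real_factor (R : rcfType) (P : {poly R}) : (1 < size P)%N ->
  (exists a, 'X - a%:P %| P) \/
  (exists a b, b != 0 /\ ('X - a%:P) ^+ 2 + (b ^+ 2)%:P %| P).
Proof.
move=> sP; have [|[a b] /= rt] := @closed_rootP _ (map_poly (real_complex R) P)
  _.
  by rewrite size_map_poly; case: ltngtP sP.
have [b0|b0] := eqVneq b 0.
  left; exists a; rewrite dvdp_XsubCl.
  by move: rt; rewrite b0 (fmorph_root (real_complex R)).
right; exists a, b; split=> //; set Q : {poly R} := _ + _.
have sQ : size Q = 3%N.
  rewrite /Q size_polyDl size_exp_XsubC //.
  by apply: leq_ltn_trans (size_polyC_leq1 _) _.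
have Qz : root (map_poly (real_complex R) Q) (a +i* b)%C.
  rewrite /Q rmorphD rmorphXn rmorphB /= map_polyX !map_polyC /=.
  rewrite rootE !hornerE_comm //=; apply/eqP; rewrite !hornerE /=.
  by apply/eqP; rewrite eq_complex /= ; apply/andP; split; apply/eqP => /=;
    ring.
have sr : (size (P %% Q)%R <= 2)%N.
  by rewrite -ltnS -sQ ltn_modp -size_poly_eq0 sQ.
have : root (map_poly (real_complex R) (P %% Q)) (a +i* b)%C.
  have := rt; rewrite {1}(divp_eq P Q) rmorphD rmorphM /= !rootE !hornerE.
  by rewrite (eqP (Qz : _ == 0)) mulr0 add0r.
rewrite rootE (horner_coef_wide _ (_ : (_ <= 2)%N)) ?size_map_poly //.
rewrite 2!big_ord_recl big_ord0 !coef_map /= expr0 expr1 mulr1 addr0 eq_complex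
  /=.
rewrite /bump /= !addn0 => /andP [/eqP h1 /eqP h2].
have c1 : (P %% Q)`_1 = 0.
  by apply/(mulIf b0); rewrite mul0r -[RHS]h2; ring.
have c0 : (P %% Q)`_0 = 0 by rewrite -[RHS]h1 c1; ring.
apply/eqP/polyP => i; rewrite coef0.
by case: i => [|[|i]] //; rewrite nth_default // (leq_trans sr).
Qed.

Lemma linear_bundle (R : nzRingType) (U V : lmodType R) (f : U -> V) :
  linear f -> exists g : {linear U -> V}, f = g.
Proof.
move=> fl; pose fL := GRing.isLinear.Build R U V *:%R f fl.
by exists (HB.pack_for {linear U -> V} f fL).
Qed.

Lemma scalar_bundle (R : nzRingType) (U : lmodType R) (f : U -> R) :
  scalar f -> exists g : {scalar U}, f = g.
Proof.
move=> fl; pose fL := GRing.isLinear.Build R U R *%R f fl.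
by exists (HB.pack_for {scalar U} f fL).
Qed.

(** * The standard units of the real division algebras *)

Section DivalgUnits.
Variable R : rcfType.
Implicit Type k : divalg_kind.

Definition divalg_units k : seq (divalg R k) :=
  match k with
  | RealD => [:: (1 : R^o)]
  | ComplexD => [:: (1 : Rcomplex R); (0 +i* 1)%C : Rcomplex R]
  | QuaternionD =>
      [:: Quat 1 0 0 0; Quat 0 1 0 0; Quat 0 0 1 0; Quat 0 0 0 1 : quat R]
  end.

Definition divalg_re k : divalg R k -> R :=
  match k with
  | RealD => fun x : R^o => x
  | ComplexD => fun x : Rcomplex R => complex.Re x
  | QuaternionD => @qre R
  end.

Definition divalg_sunits k := divalg_units k ++ map -%R (divalg_units k).

Fact divalg_re_linear k : scalar (@divalg_re k).
Proof. by case: k => // c [a b] [a' b']. Qed.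
HB.instance Definition _ k := GRing.isLinear.Build R (divalg R k) R *%R
  (@divalg_re k) (@divalg_re_linear k).

Lemma divalg_re1 k : divalg_re (1 : divalg R k) = 1.
Proof. by case: k. Qed.

Lemma divalg_expansion k (x : divalg R k) :
  x = \sum_(u <- divalg_units k) divalg_re (x * star u) *: u.
Proof.
case: k x => [x|[a b]|[a b c d]] /=; rewrite !big_cons big_nil.
- by rewrite addr0; exact: esym (etrans (mulr1 (x * 1 : R)) (mulr1 (x : R))).
- by congr Complex => /=; ring.
- by congr Quat => /=; ring.
Qed.

Lemma divalg_parseval k (x : divalg R k) :
  divalg_re (x * star x) =
    \sum_(u <- divalg_units k) divalg_re (x * star u) ^+ 2.
Proof.
case: k x => [x|[a b]|[a b c d]] /=; rewrite !big_cons big_nil.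
- by rewrite addr0; exact: esym (congr1 (fun y : R => y ^+ 2) (mulr1 (x : R))).
- by rewrite /=; ring.
- by rewrite /=; ring.
Qed.

Lemma divalg_norm k (x : divalg R k) : x * star x = divalg_re (x * star x) *:
  (1 : divalg R k).
Proof.
case: k x => [x|[a b]|[a b c d]] /=.
- exact: esym (mulr1 (x * x : R)).
- by congr Complex => /=; ring.
- by congr Quat => /=; ring.
Qed.

Lemma divalg_norm_eq0 k (x : divalg R k) : divalg_re (x * star x) = 0 -> x = 0.
Proof.
rewrite divalg_parseval => /eqP; rewrite psumr_eq0; last by move=> u _;
  exact: sqr_ge0.
move=> /allP xu; rewrite (divalg_expansion x) big_seq big1 // => u /xu.
by rewrite sqrf_eq0 => /eqP ->; rewrite scale0r.
Qed.

(** The sum is [star x] over the reals, 0 over the complex numbers and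
    [- 2 star x] over the quaternions. *)
Lemma divalg_units_sandwich k (x : divalg R k) :
  \sum_(u <- divalg_units k) u * x * u =
    (2 - (\dim {: divalg R k})%:R) *: star x.
Proof.
rewrite dim_divalg; case: k x => [x|[a b]|[a b c d]] /=;
  rewrite !big_cons big_nil.
- rewrite addr0 mul1r mulr1; rewrite -[RHS]/((2 - 1) * (x : R) : R); ring.
- by congr Complex => /=; ring.
- by congr Quat => /=; ring.
Qed.

Lemma divalg_unitV k u : u \in divalg_units k -> u * star u = 1 /\ star u = u \/
  u * star u = 1 /\ star u = - u.
Proof.
case: k u => u /=; rewrite !inE.
- by move=> /eqP ->; left; split; rewrite ?star1 ?mulr1.
- move=> /orP [] /eqP ->; [left|right];
  by split; congr Complex => /=; ring.
- move=> /or4P [] /eqP ->; [left|right|right|right];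
  by split; congr Quat => /=; ring.
Qed.

Lemma divalg_units1 k : 1 \in divalg_units k.
Proof. by case: k; rewrite /= !inE eqxx. Qed.

Lemma divalg_unitsM k u v : u \in divalg_units k -> v \in divalg_units k ->
  exists2 w, w \in divalg_units k & u * v = w \/ u * v = - w.
Proof.
case: k u v => u v /=; rewrite !inE.
- move=> /eqP -> /eqP ->; exists 1; first by rewrite inE.
  by left; rewrite mulr1.
- move=> /orP [] /eqP -> /orP [] /eqP ->;
  [exists 1|exists (0 +i* 1)%C|exists (0 +i* 1)%C|exists 1];
  rewrite ?inE ?eqxx ?orbT //;
  by [left; congr Complex => /=; ring|right; congr Complex => /=; ring].
- move=> /or4P [] /eqP -> /or4P [] /eqP ->;
  [exists (Quat 1 0 0 0)|exists (Quat 0 1 0 0)|exists (Quat 0 0 1 0)|exists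
    (Quat 0 0 0 1)
  |exists (Quat 0 1 0 0)|exists (Quat 1 0 0 0)|exists (Quat 0 0 0 1)|exists
    (Quat 0 0 1 0)
  |exists (Quat 0 0 1 0)|exists (Quat 0 0 0 1)|exists (Quat 1 0 0 0)|exists
    (Quat 0 1 0 0)
  |exists (Quat 0 0 0 1)|exists (Quat 0 0 1 0)|exists (Quat 0 1 0 0)|exists
    (Quat 1 0 0 0)];
  rewrite ?inE ?eqxx ?orbT //;
  by [left; congr Quat => /=; ring|right; congr Quat => /=; ring].
Qed.

Lemma mem_sunits k u :
  (u \in divalg_sunits k) = (u \in divalg_units k) || (- u \in divalg_units k).
Proof.
rewrite mem_cat; congr (_ || _); apply/mapP/idP => [[v vU ->]|uU].
  by rewrite opprK.
by exists (- u); rewrite ?opprK.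
Qed.

Lemma sunitsN k u : (- u \in divalg_sunits k) = (u \in divalg_sunits k).
Proof. by rewrite !mem_sunits opprK orbC. Qed.

Lemma sub_sunits k u : u \in divalg_units k -> u \in divalg_sunits k.
Proof. by rewrite mem_sunits => ->. Qed.

Lemma sunitsP k u : u \in divalg_sunits k ->
  exists2 w, w \in divalg_units k & u = w \/ u = - w.
Proof.
rewrite mem_sunits => /orP [] uU; first by exists u => //; left.
by exists (- u) => //; right; rewrite opprK.
Qed.

Lemma sunitsM k u v : u \in divalg_sunits k -> v \in divalg_sunits k ->
  u * v \in divalg_sunits k.
Proof.
move=> /sunitsP [u' uU hu] /sunitsP [v' vU hv].
have [w wU hw] := divalg_unitsM uU vU; have wS := sub_sunits wU.
by case: hu => ->; case: hv => ->; rewrite ?mulrN ?mulNr ?opprK ?sunitsN;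
   case: hw => ->; rewrite ?sunitsN.
Qed.

Lemma sunits_star k u : u \in divalg_sunits k -> star u \in divalg_sunits k.
Proof.
move=> /sunitsP [w wU hu]; have wS := sub_sunits wU.
by case: hu => ->; rewrite ?linearN /= ?sunitsN;
   case: (divalg_unitV wU) => [[_ ->]|[_ ->]]; rewrite ?sunitsN.
Qed.

Lemma sunitsV k u : u \in divalg_sunits k -> u * star u = 1.
Proof.
move=> /sunitsP [w wU hu]; have wV : w * star w = 1.
  by case: (divalg_unitV wU) => [[]|[]].
by case: hu => ->; rewrite ?linearN /= ?mulrNN.
Qed.

Lemma divalg_neq01 k : 1 != 0 :> divalg R k.
Proof.
apply/eqP => h; have := divalg_re1 k; rewrite h linear0 => /eqP.
by rewrite eq_sym oner_eq0.
Qed.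

Lemma sunits_neq0 k u : u \in divalg_sunits k -> u != 0.
Proof.
move=> /sunitsV uV; apply: contraTneq (divalg_neq01 k) => u0.
by rewrite -uV u0 mul0r eqxx.
Qed.

Lemma size_divalg_units k : size (divalg_units k) = \dim {: divalg R k}.
Proof. by rewrite dim_divalg; case: k. Qed.

End DivalgUnits.

(** * Minimal projections *)

Section PositiveFunctional.
Variables (R : rcfType) (A : starAlgType R) (tau : {scalar A}).
Hypothesis tau_pos : forall a : A, a != 0 -> 0 < tau (star a * a).
Implicit Types (a e h p : A).

Lemma star_mul_neq0 a : a != 0 -> star a * a != 0.
Proof.
by move=> /tau_pos; apply: contraTneq => ->; rewrite linear0 ltxx.
Qed.

Lemma tau_ge0 a : 0 <= tau (star a * a).
Proof.
have [->|/tau_pos/ltW//] := eqVneq a 0.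
by rewrite mulr0 linear0.
Qed.

Definition minimal_projection e := [/\ projection e, e != 0 &
  forall h, star h = h -> e * h = h -> exists k : R, h = k *: e].

(** Take an annihilator of [h] of least degree and write it as a factor
    [X - a], or [(X - a) ^ 2 + b ^ 2], times [S]. Then [k := S(h)] is a nonzero
    hermitian element killed by the value of the factor. Positivity rules out
    the quadratic factor, and an eigenvector [k] that is a polynomial in [h]
    satisfies [k * k = S(a) k], so it is a multiple of a projection. *)
Lemma split_projection e : projection e -> e != 0 ->
  minimal_projection e \/
  exists p, [/\ projection p, p != 0, e * p = p & e - p != 0].
Proof.
move=> [se ee] e0.
have [[h [sh eh hk]]|nex] := pselect (exists h,
    [/\ star h = h, e * h = h & forall k : R, h <> k *: e]); last first.
  left; split=> // h sh eh; apply: contrapT => nk; apply: nex.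
  by exists h; split=> // k hk; apply: nk; exists k.
right; have he : h * e = h by rewrite -sh -[X in _ * X]se -starM eh.
pose ev := corner_eval e h.
have evC (c : R) (S : {poly R}) : ev (c%:P * S) = c *: ev S.
  by rewrite mul_polyC /ev linearZ.
have evD (S T : {poly R}) : ev (S + T) = ev S + ev T by rewrite /ev linearD.
(* The sizes of the nonzero polynomials that annihilate [h]. *)
pose Pr n := `[< exists P : {poly R}, [/\ P != 0, ev P = 0 & size P = n] >].
have exPr : exists n, Pr n.
  have [P P0 evP] := corner_annihilator e h.
  by exists (size P); apply/asboolP; exists P.
case: (ex_minnP exPr) => n /asboolP [P [P0 evP <-]] minP {n exPr}.
have nz (S : {poly R}) : S != 0 -> (size S < size P)%N -> ev S != 0.
  move=> S0; apply: contraTneq => evS; rewrite -leqNgt; apply: minP.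
  by apply/asboolP; exists S.
have sP : (1 < size P)%N.
  rewrite ltn_neqAle eq_sym size_poly_gt0 P0 andbT.
  apply/negP => /size_poly1P [c c0 Pc]; move: evP.
  rewrite Pc -[c%:P]mulr1 evC /ev corner_eval1 => /eqP.
  by rewrite scaler_eq0 (negbTE c0) (negbTE e0).
have evXB (c : R) (S : {poly R}) : ev (('X - c%:P) * S) = h * ev S - c *: ev S.
  by rewrite mulrBl -evC /ev linearB /= corner_evalXM.
have Pfactor (Q : {poly R}) : Q %| P -> (1 < size Q)%N ->
    exists S, P = Q * S /\ ev S != 0.
  move=> /dvdpP [S PE] sQ; exists S; rewrite mulrC; split=> //.
  have S0 : S != 0 by apply: contraNneq P0 => S0; rewrite PE S0 mul0r.
  have Q0 : Q != 0 by apply: contraTneq sQ => ->; rewrite size_poly0.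
  apply: nz => //; rewrite PE size_mul //.
  by case: (size Q) sQ => [|[|m]] // _; rewrite !addnS ltnS leq_addr.
have [[a aP]|[a [b [b0 QP]]]] := poly_real_factor sP.
  have [|S [PE k0]] := Pfactor _ aP; first by rewrite size_XsubC.
  set k := ev S in k0; have hk' : h * k = a *: k.
    by apply/eqP; rewrite -subr_eq0 -evXB -PE evP.
  have ek : e * k = k by rewrite /k /ev corner_evalMe.
  have sk : star k = k by rewrite /k /ev corner_eval_star.
  have kk : k * k = S.[a] *: k by rewrite {1}/k /ev; apply: corner_eval_eigen.
  have Sa : S.[a] != 0.
    have := star_mul_neq0 k0; rewrite sk kk.
    by apply: contraNneq => ->; rewrite scale0r.
  (* If [e] were this projection, [h] would be the scalar [a]. *)
  exists (S.[a]^-1 *: k); split.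
  - split; first by rewrite linearZ /= sk.
    by rewrite -stalgAl -stalgAr kk [X in _ *: X]scalerA mulVf ?scale1r.
  - by rewrite scaler_eq0 invr_eq0 (negbTE Sa).
  - by rewrite -stalgAr ek.
  - rewrite subr_eq0; apply/eqP => ekE; apply: (hk a).
    by rewrite -[LHS]he [in LHS]ekE -stalgAr hk' [in RHS]ekE !scalerA mulrC.
have [|S [PE k0]] := Pfactor _ QP.
  rewrite size_polyDl size_exp_XsubC //.
  by apply: leq_ltn_trans (size_polyC_leq1 _) _.
set k := ev S in k0; have sk : star k = k by rewrite /k /ev corner_eval_star.
(* The quadratic factor gives [tau (star y * y) = - b ^ 2 tau (star k * k)]. *)
pose y := h * k - a *: k.
have yE : h * y - a *: y = - (b ^+ 2 *: k).
  apply/eqP; rewrite -addr_eq0; apply/eqP.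
  rewrite -[RHS]evP PE mulrDl evD expr2 -mulrA !evXB.
  by rewrite evC.
have : star y * y = - (b ^+ 2 *: (star k * k)).
  rewrite stalgAr -mulrN -yE {1}/y linearB /= linearZ /= starM sh.
  by rewrite mulrBl (mulrBr (star k) (h * y)) mulrA -(stalgAl _ (star k) y)
    (stalgAr _ (star k) y).
move=> /(congr1 tau); rewrite linearN linearZ /= => yy.
have := tau_ge0 y; rewrite yy oppr_ge0 leNgt mulr_gt0 ?tau_pos //.
by rewrite exprn_even_gt0.
Qed.

(** Repeated splitting below [e] would otherwise give arbitrarily long
    orthogonal families of projections. *)
Lemma minimal_projection_exists e : projection e -> e != 0 ->
  exists2 p, minimal_projection p & e * p = p.
Proof.
move=> pe e0; apply: contrapT => nomin.
have chain n p : projection p -> p != 0 -> e * p = p ->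
    exists s : seq A, [/\ size s = n, pairwise (fun x y => star x * y == 0) s &
      forall x, x \in s -> star x * x != 0 /\ p * x = x].
  elim: n p => [|n IH] p pp p0 ep; first by exists [::].
  have [minp|[q [pq q0 pqE r0]]] := split_projection pp p0.
    by case: nomin; exists p.
  have eqE : e * q = q by rewrite -pqE mulrA ep.
  have [s [sn ps hs]] := IH q pq q0 eqE.
  have pr := projectionB pp pq pqE; exists ((p - q) :: s); split=> /=.
  - by rewrite sn.
  - rewrite ps andbT; apply/allP => x xs; have [_ qx] := hs x xs.
    by rewrite pr.1 -qx mulrA mulrBl pqE pq.2 subrr mul0r.
  - move=> x; rewrite inE => /predU1P [->|/hs [x0 qx]].
      by split; [exact: star_mul_neq0|rewrite mulrBr pp.2 pqE].
    by split=> //; rewrite -qx mulrA pqE.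
have [s [sn ps hs]] := chain (dim A).+1 e pe e0 pe.2.
have := orthogonal_size (fun x xs => (hs x xs).1) ps.
by rewrite sn ltnn.
Qed.

End PositiveFunctional.

(** * Minimal corners *)

Section Corner.
Variables (R : rcfType) (A : starAlgType R).

Definition corner_iso (e : A) k (psi : divalg R k -> A) : Prop :=
  [/\ linear psi, {morph psi : x y / x * y}, {morph psi : x / star x},
      psi 1 = e & forall a, e * a * e = a -> exists x, psi x = a].

(** Both sides are bilinear and the units span. *)
Lemma units_morphM k (psi : divalg R k -> A) : linear psi ->
  (forall u v, u \in divalg_units R k -> v \in divalg_units R k ->
    psi (u * v) = psi u * psi v) ->
  {morph psi : x y / x * y}.
Proof.
move=> /linear_bundle [f ->] psiM x y.
rewrite (divalg_expansion x) (divalg_expansion y).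
rewrite mulr_suml !linear_sum mulr_suml /= big_seq [RHS]big_seq.
apply: eq_bigr => u uU; rewrite !mulr_sumr linear_sum big_seq [RHS]big_seq.
apply: eq_bigr => v vU; rewrite !linearZ /= -!stalgAl -!stalgAr !linearZ /=.
by rewrite psiM // !scalerA mulrC.
Qed.

Variable tau : {scalar A}.
Hypothesis tau_pos : forall a : A, a != 0 -> 0 < tau (star a * a).

(** [star x * x] is a hermitian element of the minimal corner, hence a scalar,
    and this scalar is positive. *)
Lemma minimal_normalize (e x : A) : minimal_projection e -> x != 0 ->
  x * e = x -> exists2 c : R, c != 0 & star (c *: x) * (c *: x) = e.
Proof.
move=> [[se ee] e0 mine] x0 xe.
have ex : e * star x = star x by rewrite -[in LHS]se -starM xe.
have [| |l xl] := mine (star x * x); first by rewrite starM starK.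
  by rewrite mulrA ex.
have l0 : 0 < l.
  have := tau_pos x0; rewrite xl linearZ /= pmulr_lgt0 //.
  by have := tau_pos e0; rewrite se ee.
exists (Num.sqrt l)^-1; first by rewrite invr_eq0 gt_eqF // sqrtr_gt0.
rewrite linearZ /= -stalgAl -stalgAr xl !scalerA -invfM -expr2 sqr_sqrtr ?ltW
  //.
by rewrite mulVf ?scale1r // gt_eqF.
Qed.

(** Two skew elements anticommute up to a scalar, and the square of a
    normalised one is [- e]. Beyond [i], [j] and [i * j], no nonzero skew
    element anticommutes with these three: it would also commute with
    [i * j]. *)
Lemma corner_frobenius (e : A) : minimal_projection e ->
  exists k (psi : divalg R k -> A), corner_iso e psi.
Proof.
move=> mine; have [[se ee] e0 herm] := mine.
pose skew x := [/\ star x = - x, e * x = x & x * e = x].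
pose unit x := skew x /\ x * x = - e.
have two0 : (2 : R) != 0 by rewrite pnatr_eq0.
have hk h : star h = h -> e * h = h -> exists c : R, h = c *: e by exact: herm.
(* For a skew [x], [star x * x = - (x * x)]. *)
have normalize x : skew x -> x != 0 -> exists2 c : R, c != 0 & unit (c *: x).
  move=> [sx ex xe] x0; have [c c0 cE] := minimal_normalize mine x0 xe.
  exists c => //; split; first by split; rewrite ?linearZ /= ?sx ?scalerN //
    -?stalgAr -?stalgAl ?ex ?xe.
  by rewrite -[LHS]opprK -mulNr -scalerN -sx -[in X in X * _]linearZ cE.
(* The hermitian element [i * y + y * i] is a scalar, so adding a multiple of
   [i] to [y] makes it anticommute with [i]. *)
have anti i y : unit i -> skew y -> exists c : R, i * (y + c *: i) =
  - ((y + c *: i) * i).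
  move=> [[si ei ie] ii] [sy ey ye].
  have [| |c cE] := hk (i * y + y * i).
  - by rewrite linearD /= !starM si sy !mulrNN addrC.
  - by rewrite mulrDr !mulrA ei ey.
  exists (c / 2); apply/eqP; rewrite -addr_eq0 mulrDr mulrDl addrACA cE.
  by rewrite -stalgAr -stalgAl ii -mulr2n -scaler_nat scalerN scalerN scalerA
    mulrCA divff // mulr1 subrr.
have skewD i y (c : R) : skew i -> skew y -> skew (y + c *: i).
  move=> [si ei ie] [sy ey ye].
  by split; rewrite ?linearD ?linearZ /= ?si ?sy ?scalerN ?opprD // ?mulrDr
    ?mulrDl -?stalgAr -?stalgAl ?ei ?ie ?ey ?ye.
(* The hermitian part of [x] is a scalar. *)
have decomp x : e * x * e = x -> exists (c : R) y, skew y /\ x = c *: e + y.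
  move=> exe; have ex : e * x = x by rewrite -exe !mulrA ee.
  have xe : x * e = x by rewrite -exe -!mulrA ee.
  have esx : e * star x = star x by rewrite -[e in LHS]se -starM xe.
  have sxe : star x * e = star x by rewrite -[e in LHS]se -starM ex.
  have [| |c cE] := hk (x + star x); first by rewrite linearD /= starK addrC.
    by rewrite mulrDr ex esx.
  exists (c / 2), (2^-1 *: (x - star x)); split.
    split; first by rewrite linearZ linearB /= starK -scalerN opprB.
      by rewrite -stalgAr mulrBr ex esx.
    by rewrite -stalgAl mulrBl xe sxe.
  rewrite mulrC -scalerA -cE -scalerDr addrACA subrr addr0 -mulr2n -[x *+
    2]scaler_nat.
  by rewrite scalerA mulVf ?scale1r.
(* Without skew elements the corner is the field of real scalars. *)
have [[x [sx x0]]|nosk] := pselect (exists x, skew x /\ x != 0); last first.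
  exists RealD, (fun x : R^o => (x : R) *: e); split.
  - by move=> c x y; rewrite scalerDl scalerA.
  - by move=> x y; rewrite -stalgAl -stalgAr scalerA ee.
  - by move=> x; rewrite linearZ /= se.
  - by rewrite scale1r.
  - move=> a /decomp [c [y [sy ->]]]; exists c.
    have [->|y0] := eqVneq y 0; first by rewrite addr0.
    by case: nosk; exists y.
have [ci _ ui] := normalize x sx x0; move: (ci *: x) ui => i ui {ci x sx x0}.
have [[si ei ie] ii] := ui.
(* If nothing skew anticommutes with [i], the corner is the complex plane of
   [i]. *)
have [[y [sy yi y0]]|nosk] :=
    pselect (exists y, [/\ skew y, i * y = - (y * i) & y != 0]); last first.
  have psil : linear (fun x : Rcomplex R => complex.Re x *: e + complex.Im x *:
    i).
    move=> c [a b] [a' b'] /=; rewrite !scalerDr !scalerA !scalerDl.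
    by rewrite addrACA.
  exists ComplexD, (fun x : Rcomplex R => complex.Re x *: e + complex.Im x *:
    i); split => //.
  - apply: units_morphM => // u v; rewrite !inE => /orP [] /eqP -> /orP [] /eqP
    -> /=;
    by rewrite !(mulr0, mul0r, mulr1, mul1r, oppr0, subr0, sub0r, addr0, add0r,
      scale0r, scale1r, scaleN1r) ?(ee, ei, ie, ii).
  - by move=> [a b] /=; rewrite linearD !linearZ /= se si scalerN scaleNr.
  - by rewrite /= scale1r scale0r addr0.
  - move=> a /decomp [c [y [sy ->]]].
    have [d dE] := anti i y ui sy; exists (c +i* (- d))%C => /=.
    have [yd|yd] := eqVneq (y + d *: i) 0; last first.
      by case: nosk; exists (y + d *: i); split=> //; apply: skewD.
    by congr (_ + _); apply/eqP; rewrite scaleNr eq_sym -addr_eq0 yd.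
have [cj cj0 uj] := normalize y sy y0; have ij : i * (cj *: y) = - ((cj *:
  y) * i).
  by rewrite -stalgAr -stalgAl yi scalerN.
move: (cj *: y) uj ij => j uj ij {y cj cj0 sy yi y0}.
have [[sj ej je] jj] := uj.
pose k := i * j.
have ji : j * i = - k by rewrite /k ij opprK.
have ik : i * k = - j by rewrite /k mulrA ii mulNr ej.
have kj : k * j = - i by rewrite /k -mulrA jj mulrN ie.
have ki : k * i = j by rewrite /k ij mulNr -mulrA ii mulrN opprK je.
have jk : j * k = i by rewrite /k ij mulrN mulrA jj mulNr opprK ei.
have kk : k * k = - e by rewrite {2}/k mulrA ki jj.
have ek : e * k = k by rewrite /k mulrA ei.
have ke : k * e = k by rewrite /k -mulrA je.
have sk : star k = - k by rewrite /k starM si sj mulrNN -/k ji.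
have uk : unit k by [].
pose psi (x : quat R) := qre x *: e + qi x *: i + qj x *: j + qk x *: k.
have psil : linear psi.
  move=> c [a1 a2 a3 a4] [b1 b2 b3 b4]; rewrite /psi /= !scalerDr !scalerA
    !scalerDl.
  rewrite [RHS]addrACA; congr (_ + _); rewrite [RHS]addrACA; congr (_ + _).
  by rewrite [RHS]addrACA.
exists QuaternionD, psi; split => //.
- apply: units_morphM => // u v; rewrite !inE.
  move=> /or4P [] /eqP -> /or4P [] /eqP ->; rewrite /psi /=;
  by rewrite !(mulr0, mul0r, mulr1, mul1r, oppr0, subr0, sub0r, addr0, add0r,
    scale0r, scale1r, scaleN1r) ?(ee, ei, ie, ii, ej, je, jj, ek, ke, kk, ji,
      ik, kj, ki, jk).
- move=> [a b c d]; rewrite /psi !linearD !linearZ /= se si sj sk.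
  by rewrite !scalerN !scaleNr.
- by rewrite /psi /= scale1r !scale0r !addr0.
- move=> a /decomp [c [y0 [sy0 ->]]].
  have antiS m y : unit m -> skew y ->
      exists (d : R) z, [/\ skew z, m * z = - (z * m) & z = y + d *: m].
    move=> um sy; have [d dE] := anti m y um sy.
    by exists d, (y + d *: m); split=> //; apply: skewD => //; case: um.
  have [d1 [y1 [sy1 iy1 y1E]]] := antiS i y0 ui sy0.
  have [d2 [y2 [sy2 jy2 y2E]]] := antiS j y1 uj sy1.
  have [d3 [y3 [[_ _ y3e] ky3 y3E]]] := antiS k y2 uk sy2.
  have iy : i * y3 = - (y3 * i).
    rewrite y3E y2E !mulrDr !mulrDl iy1 -!stalgAr -!stalgAl -/k ji ik ki.
    by rewrite !scalerN !opprD !opprK.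
  have jy : j * y3 = - (y3 * j).
    rewrite y3E mulrDr mulrDl jy2 -stalgAr -stalgAl jk kj.
    by rewrite !scalerN !opprD !opprK.
  have [y30|y3n] := eqVneq y3 0.
    exists (Quat c (- d1) (- d2) (- d3)); rewrite /psi /= !scaleNr -!addrA.
    congr (_ + _); apply/eqP; rewrite eq_sym -subr_eq0 -[X in _ == X]y30.
    by rewrite y3E y2E y1E !opprD !opprK !addrA.
  (* [y3] commutes with [k = i * j] and anticommutes with [k], so it
     vanishes. *)
  have ky : k * y3 = y3 * k.
    by rewrite {1}/k -mulrA jy mulrN mulrA iy mulNr opprK -mulrA.
  have : y3 *+ 2 = 0.
    rewrite mulr2n -{1}y3e -[X in _ * X + _]opprK -kk mulrN mulrA -ky ky3.
    by rewrite mulNr opprK -mulrA kk mulrN y3e addNr.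
  by move/eqP; rewrite -scaler_nat scaler_eq0 (negbTE two0) (negbTE y3n).
Qed.

End Corner.

(** * Simple summands *)

Section Blocks.
Variables (R : rcfType) (A : starAlgType R).

(** Only data: [is_block] says that the map identifies a matrix algebra with an
    ideal of [A]. *)
Record block := Block {
  bkind : divalg_kind;
  bsize : nat;
  bmap : starmx (divalg R bkind) bsize -> A }.

Definition bunit (b : block) : A := bmap (1 : starmx (divalg R (bkind b))
  (bsize b)).

Definition is_block (b : block) : Prop :=
  (0 < bsize b)%N /\
  [/\ linear (@bmap b), {morph @bmap b : x y / x * y},
      {morph @bmap b : x / star x}, injective (@bmap b) &
      (forall a, bunit b * a = a * bunit b) /\
      (forall a, bunit b * a = a -> exists x, @bmap b x = a)].

Lemma bunit_projection b : is_block b -> projection (bunit b).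
Proof.
move=> [_ [_ bM bS _ _]]; split; first by rewrite -bS star1.
by rewrite -bM mulr1.
Qed.

Variable tau : {scalar A}.
Hypothesis tau_pos : forall a : A, a != 0 -> 0 < tau (star a * a).

(** A maximal orthonormal family in the left ideal [A * e]: it plays the role
    of the first column of a system of matrix units. *)
Lemma column_exists (e : A) : minimal_projection e ->
  exists s : seq A,
    [/\ forall x, x \in s -> x * e = x /\ star x * x = e,
        pairwise (fun x y => star x * y == 0) s &
        forall y, y * e = y -> (forall x, x \in s -> star x * y = 0) -> y = 0].
Proof.
move=> mine; have [[se ee] e0 _] := mine; apply: contrapT => nomax.
have chain n : exists s : seq A, [/\ size s = n,
    forall x, x \in s -> x * e = x /\ star x * x = e &
    pairwise (fun x y => star x * y == 0) s].
  elim: n => [|n [s [sn hs ps]]]; first by exists [::].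
  have [y [ye sy y0]] : exists y, [/\ y * e = y,
      forall x, x \in s -> star x * y = 0 & y != 0].
    apply: contrapT => nex; apply: nomax; exists s; split=> // y ye sy.
    apply/eqP; apply: contrapT => /negP y0.
    by apply: nex; exists y.
  have [c c0 cE] := minimal_normalize tau_pos mine y0 ye.
  exists ((c *: y) :: s); split=> /=; first by rewrite sn.
    move=> x; rewrite inE => /predU1P [->|/hs //].
    by rewrite -stalgAl ye.
  rewrite ps andbT; apply/allP => x xs.
  rewrite -[X in _ * X]starK -starM -stalgAr sy // scaler0.
  by rewrite linear0.
have [s [sn hs ps]] := chain (dim A).+1.
suff : (size s <= dim A)%N by rewrite sn ltnn.
by apply: orthogonal_size ps => x /hs [_ ->].
Qed.

(** The range projection of a maximal column is central: by maximality it fixes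
    every [a * u], hence all the columns of [a * z]. *)
Lemma block_exists (z : A) : projection z -> (forall a, z * a = a * z) ->
  z != 0 -> exists b, [/\ is_block b, bunit b != 0 & z * bunit b = bunit b].
Proof.
move=> pz zC z0; have [e mine ze] := minimal_projection_exists tau_pos pz z0.
have [[se ee] e0 _] := mine.
have [s [hs ps ms]] := column_exists mine.
pose n := size s; pose u (i : 'I_n) := tnth (in_tuple s) i.
have ue i : u i * e = u i by have [] := hs _ (mem_tnth i (in_tuple s)).
have eu i : e * star (u i) = star (u i) by rewrite -[e in LHS]se -starM ue.
have sym (x y : A) : star x * y = 0 -> star y * x = 0.
  by move=> h; rewrite -[star y * x]starK starM starK h linear0.
have uu i j : star (u i) * u j = if i == j then e else 0.
  case: eqVneq => [->|ij]; first by have [] := hs _ (mem_tnth j (in_tuple s)).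
  have lt_case (i' j' : 'I_n) : (i' < j')%N -> star (u i') * u j' = 0.
    move=> lij; apply/eqP; rewrite /u !(tnth_nth 0).
    by apply: (pairwiseP 0 ps); rewrite ?inE.
  move: ij; rewrite -(inj_eq val_inj) neq_ltn => /orP
    [/lt_case//|/lt_case/sym//].
have n0 : (0 < n)%N.
  rewrite lt0n size_eq0; apply: contraNneq e0 => s0; apply/eqP/ms => // x.
  by rewrite s0.
pose w := \sum_i u i * star (u i).
have wsu i : star (u i) * w = star (u i).
  rewrite mulr_sumr (bigD1 i) //= mulrA uu eqxx eu big1 ?addr0 // => j ji.
  by rewrite mulrA uu eq_sym (negbTE ji) mul0r.
have sw : star w = w.
  by rewrite linear_sum; apply: eq_bigr => i _; rewrite /= starM starK.
have wa (a : A) : a * e = a -> w * a = a.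
  move=> ae; apply/esym/eqP; rewrite -subr_eq0; apply/eqP/ms.
    by rewrite mulrBl -mulrA ae.
  move=> _ /(tnthP (in_tuple s)) [i ->].
  by rewrite -/(u i) mulrBr mulrA wsu subrr.
(* Taking adjoints turns this one-sided relation into centrality. *)
have wCl a : w * (a * w) = a * w.
  rewrite [a * w]mulr_sumr mulr_sumr; apply: eq_bigr => i _.
  by rewrite [a * _]mulrA mulrA wa // -mulrA ue.
have wC a : w * a = a * w.
  rewrite -[RHS]wCl mulrA; apply: (can_inj (@starK _ _)).
  by rewrite !starM sw -[LHS]wCl.
(* The matrix entries are read in the corner, through the columns [u p] and the
   rows [star (u q)]. *)
have [k [psi [psil psiM psiS psi1 psiO]]] := corner_frobenius tau_pos mine.
have [f fE] := linear_bundle psil.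
have epsi x : e * psi x = psi x by rewrite -psi1 -psiM mul1r.
have psie x : psi x * e = psi x by rewrite -psi1 -psiM mulr1.
pose phi (M : starmx (divalg R k) n) :=
  \sum_p \sum_q u p * psi (M p q) * star (u q).
have phi_row q (M : starmx (divalg R k) n) : star (u q) * phi M =
  \sum_r psi (M q r) * star (u r).
  rewrite /phi mulr_sumr (bigD1 q) //= [X in _ + X]big1 ?addr0 => [|i iq].
    rewrite mulr_sumr; apply: eq_bigr => r _.
    by rewrite !mulrA uu eqxx epsi.
  rewrite mulr_sumr big1 // => r _.
  by rewrite !mulrA uu eq_sym (negbTE iq) !mul0r.
have phi_coef (M : starmx (divalg R k) n) p q : star (u p) * phi M * u q =
  psi (M p q).
  rewrite phi_row mulr_suml (bigD1 q) //= [X in _ + X]big1 ?addr0 => [|r rq].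
    by rewrite -mulrA uu eqxx psie.
  by rewrite -mulrA uu (negbTE rq) mulr0.
have phi1 : phi 1 = w.
  apply: eq_bigr => p _; rewrite (bigD1 p) //= [X in _ + X]big1 ?addr0.
    by rewrite mxE eqxx psi1 ue.
  by move=> q qp; rewrite mxE eq_sym (negbTE qp) fE linear0 mulr0 mul0r.
have psi_inj : injective psi.
  rewrite fE; apply: raddf_inj => x fx; apply/eqP; apply: contrapT => /negP x0.
  have : f (x * star x) = 0 by rewrite -fE psiM fE fx mul0r.
  rewrite divalg_norm linearZ /= -fE psi1 => /eqP.
  rewrite scaler_eq0 (negbTE e0) orbF => /eqP /divalg_norm_eq0 x00.
  by rewrite x00 eqxx in x0.
have phi_onto a : w * a = a -> exists M, phi M = a.
  move=> wa'.
  have H (pq : 'I_n * 'I_n) : exists x, psi x = star (u pq.1) * a * u pq.2.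
    by apply: psiO; rewrite !mulrA eu -mulrA ue.
  have [g gE] := choice H; exists (\matrix_(p, q) g (p, q)).
  rewrite -[RHS]wa' wC -[X in X * w]wa' {1}/w !mulr_suml; apply: eq_bigr => p _.
  rewrite /w mulr_sumr; apply: eq_bigr => q _.
  by rewrite mxE gE /= !mulrA.
exists (@Block k n phi); split.
- split=> //; split => /=.
  + move=> c M M'; rewrite /phi scaler_sumr -big_split;
    apply: eq_bigr => p _ /=.
    rewrite scaler_sumr -big_split; apply: eq_bigr => q _ /=.
    by rewrite !mxE fE linearP mulrDr mulrDl -stalgAr -stalgAl.
  + move=> M M'; rewrite [in RHS]/phi mulr_suml; apply: eq_bigr => p _.
    under eq_bigr => r _ do rewrite mxE fE linear_sum -fE mulr_sumr mulr_suml.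
    rewrite exchange_big mulr_suml; apply: eq_bigr => q _ /=.
    rewrite -mulrA phi_row mulr_sumr; apply: eq_bigr => r _.
    by rewrite psiM !mulrA.
  + move=> M; rewrite /phi linear_sum exchange_big; apply: eq_bigr => p _ /=.
    rewrite linear_sum; apply: eq_bigr => q _ /=.
    by rewrite !starM starK -psiS mulrA !mxE.
  + move=> M M' MM'; apply/matrixP => p q; apply: psi_inj.
    by rewrite -!phi_coef MM'.
  + rewrite /bunit /= phi1; split=> // a; exact: phi_onto.
- rewrite /bunit /= phi1; apply: contraNneq e0 => w0.
  have <- : star (u (Ordinal n0)) * u (Ordinal n0) = e by rewrite uu eqxx.
  by rewrite -wsu w0 mulr0 mul0r.
- rewrite /bunit /= phi1 mulr_sumr; apply: eq_bigr => i _.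
  by rewrite mulrA -[u i]ue mulrA zC -(mulrA (u i)) ze.
Qed.

Lemma complement_projection (s : seq A) :
  (forall x, x \in s -> projection x /\ forall a, x * a = a * x) ->
  pairwise (fun x y => x * y == 0) s ->
  [/\ projection (1 - \sum_(x <- s) x),
      forall a, (1 - \sum_(x <- s) x) * a = a * (1 - \sum_(x <- s) x) &
      forall x, x \in s -> x * (1 - \sum_(x <- s) x) = 0].
Proof.
elim: s => [_ _|z s IH hs /= /andP [/allP zs ps]].
  by rewrite big_nil subr0; split=> // [|a];
    [exact: projection1|rewrite mul1r mulr1].
have [|pr rC rs] := IH _ ps; first by move=> x xs; apply: hs;
  rewrite inE xs orbT.
have [pz zC] := hs z (mem_head _ _).
rewrite big_cons opprD addrCA addrC; set r := 1 - _ in pr rC rs *.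
have rz : r * z = z.
  rewrite /r mulrBl mul1r mulr_suml big1_seq ?subr0 // => x /andP [_ xs].
  by rewrite -zC (eqP (zs x xs)).
split; first exact: projectionB.
  by move=> a; rewrite mulrBl mulrBr rC zC.
move=> x; rewrite inE mulrBr => /predU1P [->|xs].
  by rewrite -rC rz pz.2 subrr.
by rewrite rs // -zC (eqP (zs x xs)) subrr.
Qed.

Let sblock := {b : block | is_block b}.

(** Summands are split off below the complement of those already found. *)
Lemma blocks_exist : exists s : seq sblock,
  pairwise (fun b c => bunit (sval b) * bunit (sval c) == 0) s /\
  \sum_(b <- s) bunit (sval b) = 1.
Proof.
pose un (b : sblock) := bunit (sval b).
apply: contrapT => nosum.
have hun b : projection (un b) /\ forall a, un b * a = a * un b.
  split; first exact: bunit_projection (svalP b).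
  by have [_ [_ _ _ _ [bC _]]] := svalP b.
have hs s : forall x, x \in map un s ->
    projection x /\ forall a, x * a = a * x.
  by elim: s => //= b s IH x; rewrite inE => /predU1P [->|/IH].
have chain n : exists s : seq sblock, [/\ size s = n,
    pairwise (fun x y => x * y == 0) (map un s) & all (fun x => x !=
      0) (map un s)].
  elim: n => [|n [s [sn ps nz]]]; first by exists [::].
  have [pr rC rs] := complement_projection (@hs s) ps.
  rewrite big_map in pr rC rs; set r := 1 - _ in pr rC rs.
  have r0 : r != 0.
    rewrite subr_eq0; apply/eqP => s1; apply: nosum; exists s; split=> //.
    by rewrite pairwise_map in ps.
  have [b [bb b0 rb]] := block_exists pr rC r0.
  exists (exist _ b bb :: s); split=> /=; rewrite ?sn ?ps ?nz ?andbT //.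
  apply/allP => x xs; have [_ bC] := hun (exist _ b bb).
  by rewrite bC /un /= -rb mulrA rs // mul0r.
have [s [sn ps /allP nz]] := chain (dim A).+1.
suff : (size (map un s) <= dim A)%N by rewrite size_map sn ltnn.
apply: orthogonal_size.
  by move=> x xs; have [[-> ->] _] := hs _ _ xs; exact: nz.
have star_un x : x \in map un s -> star x = x by move=> /hs [[]].
apply: (@sub_in_pairwise _ (mem (map un s)) _ _ _ _ (allss _) ps).
by move=> x y xs _ xy; rewrite /= star_un.
Qed.

End Blocks.

(** * Algebras with a faithful positive functional *)

Section MatrixSumComponents.
Variables (R : realType) (N : nat) (D : 'I_N -> divalg_kind) (n : 'I_N -> nat).
Local Notation summand j := (starmx (divalg R (D j)) (n j)).
Implicit Types (x y : matrix_sum R D n) (j : 'I_N).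

Definition component j x : summand j :=
  (x : stardsum (fun j => summand j : starAlgType R)) j.

Definition of_components (f : forall j, summand j) : matrix_sum R D n :=
  mkdsum f.

Lemma of_componentsK f j : component j (of_components f) = f j.
Proof. exact: mkdsumE. Qed.

Lemma componentP x y : (forall j, component j x = component j y) -> x = y.
Proof. exact: dsumP. Qed.

Lemma component_linear j : linear (component j).
Proof. by move=> c x y; rewrite /component !mkdsumE. Qed.

Lemma component1 j : component j 1 = 1.
Proof. exact: mkdsumE. Qed.

Lemma componentM x y j : component j (x * y) = component j x * component j y.
Proof. exact: mkdsumE. Qed.

Lemma componentS x j : component j (star x) = star (component j x).
Proof. exact: mkdsumE. Qed.

End MatrixSumComponents.

(** Peeling off simple summands exhausts the algebra; their projections recover
    the components of an element. *)
Lemma positive_structure (R : realType) (A : starAlgType R) (tau : {scalar A}) :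
  (forall a : A, a != 0 -> 0 < tau (star a * a)) ->
  exists (N : nat) (D : 'I_N -> divalg_kind) (n : 'I_N -> nat)
         (phi : matrix_sum R D n -> A),
    (forall j, (0 < n j)%N) /\ star_isomorphism phi.
Proof.
move=> tau_pos; have [s [ps s1]] := blocks_exist tau_pos.
pose N := size s; pose b (j : 'I_N) := sval (tnth (in_tuple s) j).
have hb j : is_block (b j) := svalP (tnth (in_tuple s) j).
have b1 : \sum_j bunit (b j) = 1.
  by rewrite -[RHS]s1 -[in RHS](in_tupleE s) big_tuple.
have unitC j a : bunit (b j) * a = a * bunit (b j).
  by have [_ [_ _ _ _ [h _]]] := hb j.
have orth i j : i != j -> bunit (b i) * bunit (b j) = 0.
  have lt_case (i' j' : 'I_N) : (i' < j')%N ->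
      bunit (b i') * bunit (b j') = 0.
    move=> lij; pose x0 := tnth (in_tuple s) i.
    by apply/eqP; rewrite /b !(tnth_nth x0); apply: (pairwiseP x0 ps);
      rewrite ?inE.
  rewrite -(inj_eq val_inj) neq_ltn => /orP [/lt_case//|/lt_case].
  by rewrite unitC.
exists N, (fun j => bkind (b j)), (fun j => bsize (b j)).
exists (fun x => \sum_j @bmap _ _ (b j) (component j x)).
split; first by move=> j; have [] := hb j.
have bl j : linear (@bmap _ _ (b j)) by have [_ []] := hb j.
have bM j : {morph @bmap _ _ (b j) : x y / x * y} by have [_ []] := hb j.
have bS j : {morph @bmap _ _ (b j) : x / star x} by have [_ []] := hb j.
have binj j : injective (@bmap _ _ (b j)) by have [_ []] := hb j.
have bonto j : forall a, bunit (b j) * a = a -> exists x, @bmap _ _ (b j) x = a.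
  by have [_ [_ _ _ _ []]] := hb j.
have ub j x : bunit (b j) * @bmap _ _ (b j) x = @bmap _ _ (b j) x.
  by rewrite /bunit -bM mul1r.
have bb i j x y : i != j -> @bmap _ _ (b i) x * @bmap _ _ (b j) y = 0.
  move=> ij; rewrite -(ub i) -(ub j) mulrA unitC -(mulrA _ (bunit (b i))).
  by rewrite orth // mulr0 mul0r.
split.
- move=> c x y; rewrite scaler_sumr -big_split; apply: eq_bigr => j _ /=.
  by rewrite component_linear bl.
- by rewrite -[RHS]b1; apply: eq_bigr => j _; rewrite component1.
- move=> x y; rewrite mulr_suml; apply: eq_bigr => j _.
  rewrite mulr_sumr (bigD1 j) //= [X in _ + X]big1 ?addr0 => [|i ij].
    by rewrite componentM bM.
  by rewrite bb // eq_sym.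
- by move=> x; rewrite linear_sum; apply: eq_bigr => j _; rewrite componentS bS.
- have coef j (x : matrix_sum R (fun j => bkind (b j)) (fun j => bsize (b j))) :
      bunit (b j) * (\sum_i @bmap _ _ (b i) (component i x)) =
      @bmap _ _ (b j) (component j x).
    rewrite mulr_sumr (bigD1 j) //= [X in _ + X]big1 ?addr0 ?ub // => i ij.
    by rewrite /bunit bb // eq_sym.
  have onto a : exists x : matrix_sum R (fun j => bkind (b j)) (fun j => bsize
    (b j)),
      \sum_i @bmap _ _ (b i) (component i x) = a.
    have H j : exists x, @bmap _ _ (b j) x = bunit (b j) * a.
      apply: bonto; have [_ uu] := bunit_projection (hb j).
      by rewrite mulrA uu.
    exists (of_components (fun j => sval (cid (H j)))).
    rewrite -[RHS]mul1r -b1 mulr_suml; apply: eq_bigr => j _.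
    by rewrite of_componentsK; case: cid.
  have [g gE] := choice onto; exists g => // x.
  by apply: componentP => j; apply: binj; rewrite -!coef gE.
Qed.

(** * Fixed points of bounded groups *)

Lemma sum_cvg (R : realType) (T : Type) (F : set_system T) {FF : Filter F}
    (I : Type) (r : seq I) (f : I -> T -> R) (a : I -> R) :
  (forall i, f i x @[x --> F] --> a i) ->
  \sum_(i <- r) f i x @[x --> F] --> \sum_(i <- r) a i.
Proof.
move=> fa; elim: r => [|i r IH].
  by under eq_fun do rewrite big_nil; rewrite big_nil; exact: cvg_cst.
by under eq_fun do rewrite big_cons; rewrite big_cons; exact: cvgD.
Qed.

Section FixedPoint.
Variables (R : realType) (p q : nat).
Local Notation V := 'M[R]_(p, q).
Implicit Types (x y : V) (T : V -> V).

Definition sqnorm x : R := \sum_i \sum_j x i j ^+ 2.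

Lemma sqnorm_ge0 x : 0 <= sqnorm x.
Proof. by apply: sumr_ge0 => i _; apply: sumr_ge0 => j _; exact: sqr_ge0. Qed.

Lemma entry_le_sqnorm x i j : x i j ^+ 2 <= sqnorm x.
Proof.
rewrite /sqnorm (bigD1 i) //= (bigD1 j) //= -addrA lerDl addr_ge0 //.
  by apply: sumr_ge0 => k _; exact: sqr_ge0.
by apply: sumr_ge0 => k _; apply: sumr_ge0 => l _; exact: sqr_ge0.
Qed.

Lemma sqnorm_le0 x : sqnorm x <= 0 -> x = 0.
Proof.
move=> x0; apply/matrixP => i j; rewrite mxE; apply/eqP; rewrite -sqrf_eq0.
by rewrite eq_le sqr_ge0 andbT (le_trans (entry_le_sqnorm x i j)).
Qed.

(** The parallelogram identity, the source of uniform convexity below. *)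
Lemma sqnorm_midpoint x y :
  sqnorm (2^-1 *: (x + y)) + sqnorm (x - y) / 4 = (sqnorm x + sqnorm y) / 2.
Proof.
rewrite /sqnorm !mulr_suml -!big_split /= mulr_suml; apply: eq_bigr => i _.
rewrite !mulr_suml -!big_split /= mulr_suml; apply: eq_bigr => j _.
by rewrite !mxE; field.
Qed.

Definition entry_cvg (u : nat -> V) x :=
  forall i j, (fun n => u n i j) @ \oo --> x i j.

Lemma entry_cvg_scalar (L : V -> R) u x : scalar L -> entry_cvg u x ->
  (fun n => L (u n)) @ \oo --> L x.
Proof.
move=> /scalar_bundle [f ->] ux.
have LE y : f y = \sum_i \sum_j y i j * f (delta_mx i j).
  rewrite [in LHS](matrix_sum_delta y) linear_sum.
  apply: eq_bigr => i _; rewrite linear_sum; apply: eq_bigr => j _.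
  by rewrite linearZ.
under eq_fun do rewrite LE; rewrite LE.
by apply: sum_cvg => i; apply: sum_cvg => j; apply: cvgMl; exact: ux.
Qed.

Lemma entry_cauchy_cvg (u : nat -> V) :
  (forall e, 0 < e -> exists n0, forall n m, (n0 <= n)%N -> (n0 <= m)%N ->
     sqnorm (u n - u m) < e) ->
  exists x, entry_cvg u x.
Proof.
move=> uC; have H (ij : 'I_p * 'I_q) : exists l : R,
  (fun n => u n ij.1 ij.2) @ \oo --> l.
  apply/cvg_ex; apply: cauchy_cvg; apply: cauchy_exP => e e0.
  have [n0 n0P] := uC (e ^+ 2) (exprn_gt0 _ e0).
  exists (u n0 ij.1 ij.2); exists n0 => // n /= n0n.
  rewrite /ball /= -ltr_sqr ?nnegrE ?normr_ge0 ?(ltW e0) // real_normK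
    ?num_real //.
  apply: le_lt_trans (n0P n0 n _ n0n) => //.
  by have := entry_le_sqnorm (u n0 - u n) ij.1 ij.2; rewrite !mxE.
have [l lP] := choice H; exists (\matrix_(i, j) l (i, j)) => i j.
by rewrite mxE; exact: (lP (i, j)).
Qed.

Variables (S : set (V -> V)) (K : set V) (c C : R).
Hypothesis S_linear : forall T, S T -> linear T.
Hypothesis S_id : S id.
Hypothesis S_comp : forall T T', S T -> S T' -> S (T \o T').
Hypothesis c_gt0 : 0 < c.
Hypothesis S_lower : forall T x, S T -> c * sqnorm x <= sqnorm (T x).
Hypothesis S_upper : forall T x, S T -> sqnorm (T x) <= C * sqnorm x.
Hypothesis K_neq0 : K !=set0.
Hypothesis K_midpoint : forall x y, K x -> K y -> K (2^-1 *: (x + y)).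
Hypothesis K_stable : forall T x, S T -> K x -> K (T x).
Hypothesis K_closed : forall u x, (forall n, K (u n)) -> entry_cvg u x -> K x.

(** The supremum of the square norm along an orbit is uniformly convex, so it
    has a unique minimiser on [K]; since it does not increase along orbits, the
    minimiser is fixed. *)
Lemma bounded_group_fixed_point : exists2 x, K x & forall T, S T -> T x = x.
Proof.
pose f x := sup [set sqnorm (T x) | T in S].
have f_ub T x : S T -> sqnorm (T x) <= f x.
  move=> ST; apply: ub_le_sup; last by exists T.
  by exists (C * sqnorm x) => _ [T' ST' <-]; exact: S_upper.
have f_lub x M : (forall T, S T -> sqnorm (T x) <= M) -> f x <= M.
  move=> xM; apply: ge_sup; first by exists (sqnorm (id x)); exists id.
  by move=> _ [T ST <-]; exact: xM.
have f_ge0 x : 0 <= f x by apply: le_trans (sqnorm_ge0 x) (f_ub id x S_id).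
pose m := inf [set f x | x in K].
have m_lb x : K x -> m <= f x.
  move=> Kx; apply: ge_inf; last by exists x.
  by exists 0 => _ [y _ <-].
(* The midpoint of two distant near-minimisers would fall below the infimum. *)
have close e x y : K x -> K y -> f x <= m + e -> f y <= m + e ->
    c * sqnorm (x - y) <= 4 * e.
  move=> Kx Ky fx fy.
  have : m <= m + e - c * sqnorm (x - y) / 4.
    apply: le_trans (m_lb _ (K_midpoint Kx Ky)) _; apply: f_lub => T ST.
    have [g gE] := linear_bundle (S_linear ST).
    have := sqnorm_midpoint (T x) (T y).
    have -> : 2^-1 *: (T x + T y) = T (2^-1 *: (x + y)).
      by rewrite gE linearZ [g (x + y)]linearD.
    have -> : T x - T y = T (x - y) by rewrite gE linearB.
    have := S_lower (x - y) ST; have := f_ub T x ST; have := f_ub T y ST.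
    lra.
  lra.
have inf_ok e : 0 < e -> exists x, K x /\ f x <= m + e.
  move=> e0; have [|_ [x Kx <-] /ltW fx] := @inf_adherent R [set f x |
    x in K] e e0.
    split; first by have [x Kx] := K_neq0; exists (f x); exists x.
    by exists 0 => _ [y _ <-].
  by exists x.
have inv_gt0 n : 0 < n.+1%:R^-1 :> R by rewrite invr_gt0.
have [u uP] := choice (fun n => inf_ok _ (inv_gt0 n)).
have inv_le n0 n : (n0 <= n)%N -> n.+1%:R^-1 <= n0.+1%:R^-1 :> R.
  by move=> n0n; rewrite lef_pV2 ?posrE // ler_nat ltnS.
have arch e : 0 < e -> exists n0, n0.+1%:R^-1 < e :> R.
  move=> e0; have := archi_boundP (ltW (_ : 0 < e^-1));
    rewrite invr_gt0 => /(_ e0) h.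
  exists (Num.bound e^-1); rewrite invf_plt ?posrE //.
  by rewrite (lt_trans h) // ltr_nat.
have [x ux] : exists x, entry_cvg u x.
  apply: entry_cauchy_cvg => e e0.
  have [|n0 n0P] := arch (c * e / 4); first by rewrite divr_gt0 ?mulr_gt0.
  exists n0 => n k n0n n0k; rewrite -(ltr_pM2l c_gt0).
  have fl l : (n0 <= l)%N -> f (u l) <= m + n0.+1%:R^-1.
    by move=> n0l; apply: le_trans (uP l).2 _; rewrite lerD2l inv_le.
  have := close _ _ _ (uP n).1 (uP k).1 (fl _ n0n) (fl _ n0k).
  by move: n0P; set d := _^-1; lra.
have Kx : K x by apply: K_closed ux => n; have [] := uP n.
have fx : f x <= m.
  apply: f_lub => T ST.
  have cv : (fun n => sqnorm (T (u n))) @ \oo --> sqnorm (T x).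
    apply: sum_cvg => i; apply: sum_cvg => j.
    have Tij : (fun n => T (u n) i j) @ \oo --> T x i j.
      apply: (@entry_cvg_scalar (fun y => T y i j)) => // a y z.
      by rewrite S_linear // !mxE.
    by under eq_fun do rewrite expr2; rewrite expr2; apply: cvgM.
  apply/ler_addgt0Pr => e e0; rewrite -(cvg_lim _ cv) //.
  have [n0 n0e] := arch e e0.
  apply: limr_le; first by apply/cvg_ex; eexists; exact: cv.
  exists n0 => // n /= n0n; apply: le_trans (f_ub T _ ST) _.
  apply: le_trans (uP n).2 _; rewrite lerD2l ltW //.
  exact: le_lt_trans (inv_le _ _ n0n) n0e.
exists x => // T ST; apply/eqP; rewrite -subr_eq0; apply/eqP/sqnorm_le0.
rewrite -(pmulr_rle0 _ c_gt0); have := @close 0 (T x) x.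
rewrite !addr0 mulr0; apply=> //; first exact: K_stable.
apply: f_lub => T' ST'; apply: le_trans fx.
by have := f_ub (T' \o T) x; apply; exact: S_comp.
Qed.
End FixedPoint.

(** * The natural topology in coordinates *)

Section NaturalTopology.
Variables (R : realType) (A : starAlgType R).
Implicit Types f g : A -> A.

Lemma coord_natural_continuous i :
  continuous ((fun a : A => v2r a 0 i) : natural A -> R).
Proof.
move=> a; apply: (@continuous_comp (natural A) 'rV[R]_(dim A) R v2r (fun v => v
  0 i)).
  exact: initial_continuous.
exact: coord_continuous.
Qed.

Lemma scalar_coord (f : {scalar A}) (a : A) :
  f a = \sum_i v2r a 0 i * f (r2v (delta_mx 0 i)).
Proof.
rewrite -[in LHS](v2rK a) [in LHS](row_sum_delta (v2r a)) !linear_sum.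
by apply: eq_bigr => i _; rewrite !linearZ.
Qed.

Lemma rV_continuous (T : topologicalType) n (f : T -> 'rV[R]_n) :
  (forall i, continuous (fun x => f x 0 i)) -> continuous f.
Proof.
move=> cf x U [P Px PU]; rewrite nbhs_filterE.
have : \forall y \near x, forall i, P 0 i (f y 0 i).
  by apply: filter_forall => i; apply: cf; exact: Px.
by apply: filterS => y Py; apply: PU => i j; rewrite ord1.
Qed.

(** The natural topology is initial for the coordinates. *)
Lemma natural_continuous f :
  (forall i, continuous ((fun a => v2r (f a) 0 i) : natural A -> R)) ->
  continuous (f : natural A -> natural A).
Proof.
by move=> cf; apply: continuous_comp_initial; exact: rV_continuous.
Qed.

(** Continuity for the natural topology, tested on coordinates; the coordinates
    of an integrand are also what is integrated. *)
Definition ccontinuous f :=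
  forall i, continuous ((fun a => v2r (f a) 0 i) : natural A -> R).

Lemma ccontinuous_scalar f (L : {scalar A}) : ccontinuous f ->
  continuous ((fun a => L (f a)) : natural A -> R).
Proof.
move=> cf; have -> : (fun a => L (f a)) =
    fun a => \sum_i v2r (f a) 0 i * L (r2v (delta_mx 0 i)).
  by apply/funext => a; exact: scalar_coord.
move=> a; apply: (@sum_cvg R (natural A) (nbhs (a :
  natural A)) (@nbhs_filter (natural A) a)) => i.
by apply: cvgMl; exact: cf.
Qed.

Lemma ccontinuous_linear f (L : {linear A -> A}) :
  ccontinuous f -> ccontinuous (L \o f).
Proof.
move=> cf i.
have Ll : scalar (fun a => v2r (L a) 0 i).
  by move=> k a b; rewrite !linearP !mxE.
have [h hE] := scalar_bundle Ll.
have -> : (fun a => v2r ((L \o f) a) 0 i) = fun a => h (f a) by rewrite -hE.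
exact: ccontinuous_scalar.
Qed.

Lemma ccontinuous_id : ccontinuous id.
Proof. exact: coord_natural_continuous. Qed.

Lemma ccontinuous_cst a : ccontinuous (fun=> a).
Proof. by move=> i; exact: (@cst_continuous (natural A) R (v2r a 0 i)). Qed.

Lemma ccontinuousD f g : ccontinuous f -> ccontinuous g ->
  ccontinuous (fun a => f a + g a).
Proof.
move=> cf cg i.
have -> : (fun a => v2r (f a + g a) 0 i) = fun a => v2r (f a) 0 i + v2r (g a) 0
  i.
  by apply/funext => a; rewrite linearD mxE.
by move=> a; exact: (cvgD (cf i a) (cg i a)).
Qed.

Lemma ccontinuousM f g : ccontinuous f -> ccontinuous g ->
  ccontinuous (fun a => f a * g a).
Proof.
move=> cf cg i.
have E a : v2r (f a * g a) 0 i =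
    \sum_k v2r (f a) 0 k * v2r (r2v (delta_mx 0 k) * g a) 0 i.
  rewrite -[in LHS](v2rK (f a)) [in LHS](row_sum_delta (v2r (f a))) linear_sum.
  rewrite mulr_suml linear_sum summxE; apply: eq_bigr => k _.
  by rewrite linearZ /= -stalgAl linearZ mxE.
have -> : (fun a => v2r (f a * g a) 0 i) = fun a =>
    \sum_k v2r (f a) 0 k * v2r (r2v (delta_mx 0 k) * g a) 0 i.
  by apply/funext.
move=> a; apply: (@sum_cvg R (natural A) (nbhs (a :
  natural A)) (@nbhs_filter (natural A) a)) => k.
apply: cvgM; first exact: cf.
have Ll : scalar (fun b => v2r (r2v (delta_mx 0 k) * b) 0 i).
  by move=> c b b'; rewrite mulrDr -stalgAr linearP !mxE.
have [h hE] := scalar_bundle Ll.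
by have := @ccontinuous_scalar g h cg; rewrite -hE => /(_ a).
Qed.

Lemma ccontinuous_sum (I : Type) (r : seq I) (F : I -> A -> A) :
  (forall i, ccontinuous (F i)) -> ccontinuous (fun a => \sum_(i <- r) F i a).
Proof.
move=> cF; elim: r => [|i r IH].
  have -> : (fun a => \sum_(i <- [::]) F i a) = fun=> 0.
    by apply/funext => a; rewrite big_nil.
  exact: ccontinuous_cst.
have -> : (fun a => \sum_(j <- i :: r) F j a) =
  fun a => F i a + \sum_(j <- r) F j a.
  by apply/funext => a; rewrite big_cons.
exact: ccontinuousD.
Qed.

Lemma compact_fun_bounded (G : set (natural A)) (f : natural A -> R) :
  compact G -> continuous f -> exists M, forall a, G a -> `|f a| <= M.
Proof.
move=> cG cf.
have /compact_bounded[M [_ mrt]] : compact (f @` G).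
  by apply: continuous_compact => //; apply: continuous_subspaceT.
by exists (M + 1) => a Ga; apply: mrt; rewrite ?ltrDl //; exists a.
Qed.

End NaturalTopology.

(** * Left multiplication as a matrix *)

Section LeftMatrix.
Variables (R : fieldType) (A : starAlgType R).
Implicit Types a b : A.

(** Vectors are rows, so [lmx] reverses products. *)
Definition lmx a : 'M[R]_(dim A) := \matrix_i v2r (a * r2v (delta_mx 0 i)).

Lemma lmxE a b : v2r b *m lmx a = v2r (a * b).
Proof.
rewrite mulmx_sum_row -[b in RHS]v2rK [in RHS](row_sum_delta (v2r b)).
rewrite !linear_sum mulr_sumr linear_sum; apply: eq_bigr => i _ /=.
by rewrite rowK !linearZ /= -stalgAr linearZ.
Qed.

Lemma row_mul_inj m n (M M' : 'M[R]_(m, n)) :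
  (forall v : 'rV_m, v *m M = v *m M') -> M = M'.
Proof. by move=> h; apply/row_matrixP => i; rewrite !rowE. Qed.

Lemma lmx_linear : linear lmx.
Proof.
move=> k a b; apply: row_mul_inj => v; rewrite -[v]r2vK mulmxDr -scalemxAr
  !lmxE.
by rewrite mulrDl linearD -stalgAl linearZ.
Qed.

Lemma lmxM a b : lmx (a * b) = lmx b *m lmx a.
Proof.
by apply: row_mul_inj => v; rewrite -[v]r2vK mulmxA !lmxE mulrA.
Qed.

Lemma lmx1 : lmx 1 = 1%:M.
Proof. by apply: row_mul_inj => v; rewrite -[v]r2vK lmxE mul1r mulmx1. Qed.

(** One-sided inverses are two-sided, by finite dimension. *)
Lemma mul_star_comm a : a * star a = 1 -> star a * a = 1.
Proof.
move=> aa; apply: (can_inj v2rK); rewrite -[LHS]mulmx1 -(mulr1 (_ * a)) -lmxE.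
rewrite lmxM (mulmx1C (_ : lmx (star a) *m lmx a = 1%:M)) ?mulmx1 //.
by rewrite -lmxM aa lmx1.
Qed.

End LeftMatrix.

(** * The invariant inner product *)

Section SqnormBounds.
Variable R : realType.

Lemma sqnorm_tr m n (x : 'M[R]_(m, n)) : sqnorm x^T = sqnorm x.
Proof.
rewrite /sqnorm exchange_big; apply: eq_bigr => i _; apply: eq_bigr => j _.
by rewrite mxE.
Qed.

Lemma sqnorm_row n (v : 'rV[R]_n) : sqnorm v = (v *m v^T) 0 0.
Proof.
by rewrite /sqnorm big_ord1 mxE; apply: eq_bigr => i _; rewrite mxE expr2.
Qed.

Lemma sqnorm_mull m n p (M : R) : exists C : R,
  forall (x : 'M[R]_(m, n)) (y : 'M[R]_(n, p)),
    (forall i j, `|x i j| <= M) -> sqnorm (x *m y) <= C * sqnorm y.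
Proof.
exists ((M *+ n) ^+ 2 *+ p *+ m) => x y xM.
have -> : (M *+ n) ^+ 2 *+ p *+ m * sqnorm y =
    \sum_(i < m) \sum_(j < p) ((M *+ n) ^+ 2 * sqnorm y).
  by rewrite !sumr_const !card_ord !mulrnAl.
apply: ler_sum => i _; apply: ler_sum => j _.
rewrite -(sqr_sqrtr (sqnorm_ge0 y)) -exprMn; set s := Num.sqrt _.
have ys k : `|y k j| <= s by rewrite -sqrtr_sqr ler_wsqrtr // entry_le_sqnorm.
have xy : `|(x *m y) i j| <= M *+ n * s.
  rewrite mxE; apply: le_trans (ler_norm_sum _ _ _) _.
  rewrite mulrnAl -[in leRHS](card_ord n) -sumr_const; apply: ler_sum => k _.
  by rewrite normrM ler_pM.
rewrite -[leLHS]real_normK ?num_real //; apply: lerXn2r; rewrite ?nnegrE //.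
exact: le_trans (normr_ge0 _) xy.
Qed.

End SqnormBounds.

Section InvariantForm.
Variables (R : realType) (A : starAlgType R).
Hypothesis polA : polarizable A.
Local Notation U := (@unitary_group R A).

Lemma unitary_lmx_bounded : exists M : R, forall u, U u -> forall i j,
  `|lmx u i j| <= M.
Proof.
have [cU _] := polA.
have H (ij : 'I_(dim A) * 'I_(dim A)) : exists M, forall u,
  U u -> `|lmx u ij.1 ij.2| <= M.
  have fl : scalar (fun a : A => lmx a ij.1 ij.2).
    by move=> k a b; rewrite lmx_linear !mxE.
  have [f fE] := scalar_bundle fl.
  have [M MP] := compact_fun_bounded cU (@ccontinuous_scalar _ _ id f
    (@ccontinuous_id _ A)).
  by exists M => u /MP; rewrite -fE.
have [M MP] := choice H.
exists (\sum_ij `|M ij|) => u Uu i j; apply: le_trans (MP (i, j) u Uu) _.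
apply: le_trans (ler_norm _) _; rewrite (bigD1 (i, j)) //= lerDl.
by apply: sumr_ge0 => ij _; exact: normr_ge0.
Qed.

Lemma unitary1 : U 1.
Proof. by rewrite /unitary_group /= star1 mulr1. Qed.

Lemma unitaryM u v : U u -> U v -> U (u * v).
Proof.
by rewrite /unitary_group /= => uu vv; rewrite starM mulrA -(mulrA u) vv mulr1.
Qed.

Lemma unitaryS u : U u -> U (star u).
Proof. by rewrite /unitary_group /= starK => /mul_star_comm. Qed.

(** The forms that dominate a fixed multiple of the square norm after every
    transport by a unitary element make up a closed convex set, stable under
    the group. It contains the standard form, because unitary elements distort
    the norm by a bounded factor, and all its members are positive definite. *)
Lemma invariant_form : exists S : 'M[R]_(dim A),
  (forall v : 'rV_(dim A), v != 0 -> 0 < (v *m S *m v^T) 0 0) /\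
  (forall u, U u -> lmx u *m S *m (lmx u)^T = S).
Proof.
have [M MP] := unitary_lmx_bounded.
have MPt u : U u -> forall i j, `|(lmx u)^T i j| <= M.
  by move=> Uu i j; rewrite mxE; exact: MP.
have [C0 C0P] := @sqnorm_mull R (dim A) (dim A) (dim A) M.
have [C1 C1P] := @sqnorm_mull R (dim A) (dim A) 1 M.
pose C := `|C0| + `|C1| + 1.
have C_gt0 : 0 < C by rewrite ltr_wpDl // addr_ge0.
have CP u (X : 'M[R]_(dim A)) : U u -> sqnorm (lmx u *m X) <= C * sqnorm X.
  move=> Uu; apply: le_trans (C0P _ _ (MP u Uu)) _;
    rewrite ler_wpM2r ?sqnorm_ge0 //.
  by rewrite /C -addrA (le_trans (ler_norm _)) // lerDl addr_ge0.
have CPv u (v : 'rV[R]_(dim A)) : U u -> sqnorm (v *m lmx u) <= C * sqnorm v.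
  move=> Uu; rewrite -sqnorm_tr -(sqnorm_tr v) trmx_mul.
  apply: le_trans (C1P _ _ (MPt u Uu)) _; rewrite ler_wpM2r ?sqnorm_ge0 //.
  by rewrite /C addrAC addrC (le_trans (ler_norm _)) // lerDl addr_ge0.
have lmxK u : U u -> lmx u *m lmx (star u) = 1%:M.
  by move=> Uu; rewrite -lmxM (mul_star_comm Uu) lmx1.
pose act u (X : 'M[R]_(dim A)) := lmx u *m X *m (lmx u)^T.
have act_upper u X : U u -> sqnorm (act u X) <= C ^+ 2 * sqnorm X.
  move=> Uu; rewrite -sqnorm_tr trmx_mul trmxK; apply: le_trans (CP _ _ Uu) _.
  by rewrite expr2 -mulrA ler_pM2l // sqnorm_tr CP.
have actM u u' X : act u (act u' X) = act (u' * u) X.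
  by rewrite /act lmxM trmx_mul !mulmxA.
have act1 X : act 1 X = X by rewrite /act lmx1 trmx1 mul1mx mulmx1.
pose T := [set act u | u in U].
pose K : set 'M[R]_(dim A) := [set X | forall u (v : 'rV_(dim A)), U u ->
  sqnorm v <= C * (v *m act u X *m v^T) 0 0].
have form_scalar u (v : 'rV_(dim A)) : scalar (fun X => (v *m act u X *m v^T) 0
  0).
  move=> k X Y; rewrite /act mulmxDr mulmxDl mulmxDr mulmxDl.
  by rewrite -!scalemxAr -!scalemxAl -!scalemxAr -!scalemxAl !mxE.
have C2 : 0 < C ^+ 2 by rewrite exprn_gt0.
have [X KX fixX] : exists2 X, K X & forall t, T t -> t X = X.
  apply: (@bounded_group_fixed_point _ _ _ T K (C ^+ 2)^-1 (C ^+ 2)).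
  - move=> _ [u _ <-] k X Y; rewrite /act mulmxDr mulmxDl.
    by rewrite -scalemxAr -scalemxAl.
  - by exists 1; [exact: unitary1|apply/funext => X; rewrite act1].
  - move=> _ _ [u Uu <-] [u' Uu' <-]; exists (u' * u); first exact: unitaryM.
    by apply/funext => X /=; rewrite actM.
  - by rewrite invr_gt0.
  - move=> _ X [u Uu <-]; rewrite ler_pdivrMl //.
    have -> : sqnorm X = sqnorm (act (star u) (act u X)).
      by rewrite actM [u * star u]Uu act1.
    exact/act_upper/unitaryS.
  - by move=> _ X [u Uu <-]; exact: act_upper.
  - exists 1%:M => u v Uu; rewrite /act mulmx1 mulmxA -mulmxA -trmx_mul
    -sqnorm_row.
    rewrite -[in leLHS](mulmx1 v) -(lmxK u Uu) mulmxA; apply: CPv;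
      exact: unitaryS.
  - move=> X Y KX KY u v Uu; have [f fE] := scalar_bundle (form_scalar u v).
    rewrite -[X in C * X]/((fun X => (v *m act u X *m v^T) 0 0) _) fE.
    rewrite linearZ linearD /= -fE.
    by have := KX u v Uu; have := KY u v Uu; lra.
  - move=> _ X [u Uu <-] KX u' v Uu'; rewrite actM; apply: KX; exact: unitaryM.
  - move=> Xn X KXn cvX u v Uu.
    have cv := entry_cvg_scalar (form_scalar u v) cvX.
    rewrite mulrC -ler_pdivrMr //.
    rewrite -(cvg_lim _ cv) //; apply: limr_ge; first by apply/cvg_ex; eexists;
      exact: cv.
    by apply: nearW => n; rewrite ler_pdivrMr // mulrC; exact: KXn.
exists X; split=> [v v0|u Uu]; last by apply: (fixX (act u)); exists u.
have := KX 1 v unitary1; rewrite act1 => h.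
rewrite -(pmulr_rgt0 _ C_gt0); apply: lt_le_trans h.
rewrite lt_neqAle sqnorm_ge0 andbT eq_sym; apply: contraNneq v0 => sv0.
by apply/eqP/sqnorm_le0; rewrite sv0.
Qed.

(** For an invariant form [B] and unitary [u],
    [B (u * a) b = B a (star u * b)]. The elements [u] satisfying this relation
    and its adjoint form a star-subalgebra, so it holds everywhere, and
    [B a a = B (star a * a) 1]. *)
Lemma positive_functional_exists : exists tau : {scalar A},
  forall a : A, a != 0 -> 0 < tau (star a * a).
Proof.
have [S [Spos Sinv]] := invariant_form.
pose B (a b : A) := (v2r a *m S *m (v2r b)^T) 0 0.
have Bu u a b : U u -> B (u * a) (u * b) = B a b.
  move=> Uu; rewrite /B -!lmxE trmx_mul -[in RHS](Sinv u Uu).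
  by rewrite !mulmxA.
have Bl b : scalar (B^~ b).
  by move=> k a a'; rewrite /B linearP !mulmxDl -!scalemxAl !mxE.
have Br a : scalar (B a).
  by move=> k b b'; rewrite /B [v2r (_ + _)]linearP [(_ + _)^T]linearP mulmxDr
    -scalemxAr !mxE.
have [_ genU] := polA.
pose W : set A := [set c | forall a b, B (c * a) b = B a (star c * b) /\
                                   B (star c * a) b = B a (c * b)].
have WT : W = [set: A].
  apply: genU.
    split.
    - by move=> a b; rewrite star1 !mul1r.
    - move=> k c d Wc Wd a b; have [c1 c2] := Wc a b; have [d1 d2] := Wd a b.
      rewrite linearP /= !mulrDl -!stalgAl !Bl !Br.
      by rewrite c1 c2 d1 d2.
    - move=> c d Wc Wd a b; rewrite starM -!mulrA.
      by rewrite (Wc _ _).1 (Wd _ _).1 (Wd _ _).2 (Wc _ _).2.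
    - by move=> c Wc a b; have [] := Wc a b; rewrite starK.
  move=> u Uu a b; have us := mul_star_comm Uu; split.
    by rewrite -(Bu (star u)) ?mulrA ?us ?mul1r //; exact: unitaryS.
  by rewrite -(Bu u) // mulrA [u * star u]Uu mul1r.
have [tau tauE] := scalar_bundle (Bl 1).
exists tau => a a0; rewrite -tauE.
have Wa : W (star a) by rewrite WT.
rewrite (Wa a 1).1 starK mulr1; apply: Spos.
by apply: contraNneq a0 => va0; apply/eqP/(can_inj v2rK); rewrite va0 linear0.
Qed.

End InvariantForm.

(** * Haar integrals in coordinates *)

Lemma Rintegral_sum_seq d (T : measurableType d) (R : realType)
    (mu : {measure set T -> \bar R}) (D : set T) (I : Type) (r : seq I)
    (F : I -> T -> R) : measurable D ->
  (forall i, mu.-integrable D (EFin \o F i)) ->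
  \int[mu]_(x in D) (\sum_(i <- r) F i x) = \sum_(i <- r) \int[mu]_(x in D) F i
    x.
Proof.
move=> mD iF; pose S r x := \sum_(i <- r) F i x.
suff [] : mu.-integrable D (EFin \o S r) /\
    \int[mu]_(x in D) S r x = \sum_(i <- r) \int[mu]_(x in D) F i x by [].
elim: r => [|i r [IHi IH]].
  have -> : S [::] = cst 0 by apply/funext => x; rewrite /S big_nil.
  split; last by rewrite big_nil Rintegral_cst // mul0r.
  exact: integrable0.
have -> : S (i :: r) = fun x => F i x + S r x.
  by apply/funext => x; rewrite /S big_cons.
split; last by rewrite RintegralD // big_cons IH.
exact: (integrableD mD (iF i) IHi).
Qed.

Section HaarIntegral.
Variables (R : realType) (A : starAlgType R) (G : set A).
Variable mu : probability (borel A) R.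
Hypothesis cG : compact (G : set (natural A)).
Hypothesis haar : is_haar G mu.
Implicit Types f g : A -> A.

Lemma natural_compact_closed : closed (G : set (natural A)).
Proof.
have -> : (G : set (natural A)) = (v2r : natural A -> 'rV[R]_(dim A)) @^-1`
  (v2r @` G).
  apply/seteqP; split=> a /=; first by exists a.
  by move=> [b Gb] /(can_inj v2rK) <-.
apply: preimage_closed; last first.
  apply: compact_closed; first exact: norm_hausdorff.
  apply: (@continuous_compact (natural A) 'rV[R]_(dim A) v2r G) => //.
  by apply: continuous_subspaceT; exact: initial_continuous.
by move=> a _; exact: initial_continuous.
Qed.

Lemma borel_open (E : set (natural A)) : open E -> measurable (E :
  set (borel A)).
Proof. by move=> oE; apply: sub_sigma_algebra. Qed.

Lemma compact_measurable : measurable (G : set (borel A)).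
Proof.
rewrite -[X in measurable X]setCK; apply: measurableC; apply: borel_open.
by apply: closed_openC; exact: natural_compact_closed.
Qed.

Lemma borel_measurable_fun (f : natural A -> R) : continuous f ->
  measurable_fun [set: borel A] (f : borel A -> R).
Proof.
move=> /continuousP cf; apply: (measurability _
  (measurable_realfun.RGenOpens.measurableE R)).
move=> _ [_ [a [b ->] <-]]; rewrite setTI; apply: borel_open.
exact/cf/interval_open.
Qed.

Lemma continuous_integrable (f : natural A -> R) : continuous f ->
  mu.-integrable (G : set (borel A)) (EFin \o (f : borel A -> R)).
Proof.
move=> cf; apply: measurable_bounded_integrable;
  first exact: compact_measurable.
- by rewrite -ge0_fin_numE // fin_num_measure //; exact: compact_measurable.
- by apply: measurable_funTS; exact: borel_measurable_fun.
have [M MP] := compact_fun_bounded cG cf.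
by exists M; split; [exact: num_real|move=> K MK x Gx;
  apply: le_trans (MP x Gx) (ltW MK)].
Qed.

Local Notation vint := (vintegral mu G).

Lemma vintE f i : v2r (vint f) 0 i =
  \int[mu]_(g in (G : set (borel A))) v2r (f g) 0 i.
Proof. by rewrite r2vK mxE. Qed.

Lemma eq_vint f g : (forall a, G a -> f a = g a) -> vint f = vint g.
Proof.
move=> fg; congr r2v; apply/rowP => i; rewrite !mxE; apply: eq_Rintegral => a.
by rewrite inE => Ga; rewrite fg.
Qed.

Lemma vint_linear f (L : {linear A -> A}) : ccontinuous f ->
  vint (L \o f) = L (vint f).
Proof.
move=> cf; apply: (can_inj v2rK); apply/rowP => i; rewrite vintE.
have Ll : scalar (fun a => v2r (L a) 0 i) by move=> k a b;
  rewrite !linearP !mxE.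
have [h hE] := scalar_bundle Ll.
rewrite -[RHS]/((fun a => v2r (L a) 0 i) _) hE scalar_coord.
have -> : (fun a => v2r ((L \o f) a) 0 i) = fun a =>
    \sum_k v2r (f a) 0 k * h (r2v (delta_mx 0 k)).
  by apply/funext => a; rewrite -scalar_coord -hE.
have icf k := continuous_integrable (cf k).
rewrite Rintegral_sum_seq; last 2 first.
- exact: compact_measurable.
- move=> k; apply: (@continuous_integrable
      (fun a : natural A => v2r (f a) 0 k * h (r2v (delta_mx 0 k)))) => a.
  exact: (cvgM (cf k a) (cvg_cst _)).
apply: eq_bigr => k _; rewrite vintE RintegralZr //; exact: compact_measurable.
Qed.

Lemma vintD f g : ccontinuous f -> ccontinuous g ->
  vint (fun a => f a + g a) = vint f + vint g.
Proof.
move=> cf cg; apply: (can_inj v2rK); apply/rowP => i.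
rewrite linearD mxE !vintE -RintegralD; last 3 first.
- exact: compact_measurable.
- exact: continuous_integrable (cf i).
- exact: continuous_integrable (cg i).
by apply: eq_Rintegral => a _; rewrite linearD mxE.
Qed.

Lemma vint_cst a : vint (fun=> a) = a.
Proof.
apply: (can_inj v2rK); apply/rowP => i; rewrite vintE Rintegral_cst.
  by rewrite [X in fine X](_ : _ = 1%E) ?mulr1 //; exact: haar.1.
exact: compact_measurable.
Qed.

Lemma vintMl f a : ccontinuous f -> vint (fun b => a * f b) = a * vint f.
Proof.
move=> cf; have [L LE] : exists L : {linear A -> A}, (fun c => a * c) = L.
  by apply: linear_bundle => k b c; rewrite mulrDr stalgAr.
by have := @vint_linear f L cf; rewrite -LE.
Qed.

Lemma vintMr f a : ccontinuous f -> vint (fun b => f b * a) = vint f * a.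
Proof.
move=> cf; have [L LE] : exists L : {linear A -> A}, (fun c => c * a) = L.
  by apply: linear_bundle => k b c; rewrite mulrDl stalgAl.
by have := @vint_linear f L cf; rewrite -LE.
Qed.

Lemma vint_sum (I : Type) (r : seq I) (F : I -> A -> A) :
  (forall i, ccontinuous (F i)) ->
  vint (fun a => \sum_(i <- r) F i a) = \sum_(i <- r) vint (F i).
Proof.
move=> cF; elim: r => [|i r IH].
  rewrite big_nil -[RHS]vint_cst; apply: eq_vint => a _.
  by rewrite big_nil.
rewrite big_cons -IH -vintD //; last exact: ccontinuous_sum.
by apply: eq_vint => a _; rewrite big_cons.
Qed.

Hypothesis gG : unitary_subgroup G.

(** The push-forward of [mu] by translation agrees with [mu] on the measurable
    subsets of [G]. *)
Lemma vint_translate f h : ccontinuous f -> G h ->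
  vint (fun b => f (h * b)) = vint f.
Proof.
move=> cf Gh; have [GU G1 GM GS] := gG; have Ush := mul_star_comm (GU _ Gh).
congr r2v; apply/rowP => i; rewrite !mxE; congr fine.
have ch : continuous ((fun b => h * b) : natural A -> natural A).
  apply: natural_continuous.
  by apply: ccontinuousM; [exact: ccontinuous_cst|exact: ccontinuous_id].
pose phi : borel A -> borel A := fun b => h * b.
have mphi : measurable_fun [set: borel A] phi.
  apply: (@measurability _ _ _ _ setT phi (@open (natural A))) => //.
  move=> _ [E oE <-]; rewrite setTI; apply: borel_open.
  by move/continuousP : ch; exact.
pose F : borel A -> \bar R := fun a => (v2r (f a) 0 i)%:E.
have phiG : phi @^-1` G = G.
  apply/seteqP; split=> g; last exact: GM.
  by move=> /(GM _ _ (GS _ Gh)); rewrite /phi mulrA Ush mul1r.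
have := @integral_pushforward _ _ _ _ R phi mphi mu (G : set (borel A)) F.
rewrite phiG => <-.
- apply: eq_measure_integral => E mE EG.
  apply: etrans (haar.2 _ _ (GS _ Gh) mE EG); congr (mu _).
  apply/seteqP; split=> g /=.
    by exists (phi g) => //; rewrite /phi mulrA Ush mul1r.
  by move=> [a Ea <-]; rewrite /phi mulrA (GU _ Gh) mul1r.
- by apply/measurable_realfun.measurable_EFinP; exact: borel_measurable_fun.
- apply: (@continuous_integrable (fun b => v2r (f (h * b)) 0 i)).
  move=> a; apply: (@continuous_comp (natural A) (natural A) R
    (fun b => h * b) (fun b => v2r (f b) 0 i)); [exact: ch|exact: cf].
- exact: compact_measurable.
Qed.

End HaarIntegral.

(** * Averages over a polarizing group *)

Section HaarAveraging.
Variables (R : realType) (A : starAlgType R) (G : set A).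
Variable mu : probability (borel A) R.
Local Notation vint := (vintegral mu G).

(** The definition of [polarizing] provides a Haar measure [nu] of mean zero.
    The mean [p] for [mu] satisfies [g * p = p] on [G]; integrating this
    against [nu] gives [0 = p]. *)
Lemma haar_mean0 : polarizing G -> is_haar G mu -> vint id = 0.
Proof.
move=> [gG cG _ [nu hnu nu0]] hmu; pose p := vint id.
have gp g : G g -> g * p = p.
  move=> Gg; rewrite -[RHS](vint_translate cG hmu gG (@ccontinuous_id _ A) Gg).
  by rewrite vintMl //; exact: ccontinuous_id.
rewrite -/p -(vint_cst cG hnu p).
rewrite (@eq_vint _ _ _ _ (fun=> p) (fun b => b * p)); last by move=> g /gp.
by rewrite vintMr ?nu0 ?mul0r //; exact: ccontinuous_id.
Qed.

Hypothesis hG : polarizing G.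
Hypothesis hmu : is_haar G mu.

Definition sandwich a := vint (fun g => g * a * g).

Lemma sandwich_ccontinuous a : ccontinuous (fun g : A => g * a * g).
Proof.
apply: ccontinuousM; last exact: ccontinuous_id.
by apply: ccontinuousM; [exact: ccontinuous_id|exact: ccontinuous_cst].
Qed.

Lemma sandwich_linear : linear sandwich.
Proof.
have [gG cG genG _] := hG => k a b.
have cf := sandwich_ccontinuous; pose L : {linear A -> A} := *:%R k.
rewrite /sandwich -[k *: _]/(L _) -vint_linear // -vintD //.
  apply: eq_vint => g _ /=.
  by rewrite mulrDr mulrDl -stalgAr -stalgAl.
by apply: ccontinuous_linear.
Qed.

(** For [h] in [G], translating [star h * g * a * g] by [h] gives
    [g * (a * h) * g], so [sandwich (a * h) = star h * sandwich a]. This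
    relation is linear in [h], and [G] generates. *)
Lemma sandwichE b : sandwich b = star b * sandwich 1.
Proof.
have [gG cG genG _] := hG; have [GU G1 GM GS] := gG.
pose W : set A := [set b | forall a, sandwich (a * b) = star b * sandwich a /\
                                    sandwich (a * star b) = b * sandwich a].
have [T TE] := linear_bundle sandwich_linear.
suff WT : W = [set: A].
  have Wb : W b by rewrite WT.
  by have [+ _] := Wb 1; rewrite mul1r.
have GW h : G h -> forall a, sandwich (a * h) = star h * sandwich a.
  move=> Gh a; have cf := @sandwich_ccontinuous a.
  rewrite /sandwich -(vintMl mu cG (star h) cf).
  rewrite -[RHS](vint_translate cG hmu gG _ Gh); last first.
    by apply: ccontinuousM => //; exact: ccontinuous_cst.
  apply: eq_vint => g Gg.
  by rewrite !mulrA (mul_star_comm (GU _ Gh)) mul1r.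
apply: genG => [|h Gh a]; last first.
  by rewrite !GW ?starK //; exact: GS.
split.
- by move=> a; rewrite star1 mulr1 mul1r.
- move=> k c d Wc Wd a; have [c1 c2] := Wc a; have [d1 d2] := Wd a.
  move: c1 c2 d1 d2; rewrite TE => c1 c2 d1 d2.
  rewrite !linearP /= !mulrDr -!stalgAr !linearP /= !mulrDl -!stalgAl.
  by rewrite c1 c2 d1 d2.
- move=> c d Wc Wd a; rewrite starM !mulrA.
  by rewrite (Wd _).1 (Wc _).1 (Wc _).2 (Wd _).2 !mulrA.
- by move=> c Wc a; have [] := Wc a; rewrite starK.
Qed.

(** The terms in [Q x x] and [Q y y] are multiples of the mean of [g], since
    [star g * g = 1]; for the same reason the term in [Q x y] is constant. The
    remaining term is [sandwich (Q y x)]. *)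
Lemma polarization_integral (X : lmodType A) (Q : X -> X -> A) (x y : X) :
  hermitian_form Q ->
  vint (fun g => Q (x + g *: y) (x + g *: y) * g) = Q x y * (1 + sandwich 1).
Proof.
move=> [QD QZ QS]; have [gG cG genG _] := hG; have [GU G1 GM GS] := gG.
have QDr a b c : Q a (b + c) = Q a b + Q a c.
  by rewrite -QS QD linearD /= !QS.
have QZr a b (r : A) : Q a (r *: b) = Q a b * star r.
  by rewrite -QS QZ starM QS.
have cid := @ccontinuous_id _ A.
rewrite (@eq_vint _ _ _ _ _
  (fun g => Q x x * g + (Q x y + (g * Q y x * g + g * Q y y)))).
  have cMr a : ccontinuous (fun g : A => g * a).
    by apply: ccontinuousM => //; exact: ccontinuous_cst.
  have cMl a : ccontinuous (fun g : A => a * g).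
    by apply: ccontinuousM => //; exact: ccontinuous_cst.
  have cc := @ccontinuous_cst _ A; have cs := sandwich_ccontinuous.
  rewrite !vintD //; try by do ?apply: ccontinuousD.
  rewrite vintMl // vintMr // haar_mean0 // mulr0 mul0r vint_cst // addr0 add0r.
  by rewrite -/(sandwich _) sandwichE QS mulrDr mulr1.
move=> g Gg; have gg := mul_star_comm (GU _ Gg).
rewrite QD !QDr QZ !QZr !QZ !mulrDl -!mulrA gg !mulr1.
by rewrite -!addrA.
Qed.

End HaarAveraging.

Lemma mnormalize_fin d (T : measurableType d) (R : realType)
    (mu : {measure set T -> \bar R}) (P : probability T R) (r : R) (E : set T) :
  mu [set: T] = r%:E -> r != 0 -> mnormalize mu P E = (mu E * (r^-1)%:E)%E.
Proof. by move=> muT r0; rewrite /mnormalize muT eqe (negbTE r0). Qed.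

(** The normalised counting measure is invariant because translations permute
    the group. *)
Lemma finite_haar (R : realType) (A : starAlgType R) (G : set A) :
  unitary_subgroup G -> finite_set G -> exists mu, @is_haar R A G mu.
Proof.
move=> [GU G1 GM GS] /finite_seqP [s0 GE]; pose s := undup s0.
have sG a : (a \in s) = (a \in G).
  by rewrite mem_undup GE; apply/idP/idP => [as0|]; rewrite inE.
pose m := @msum _ (borel A) R (fun i => @dirac _ (borel A) (nth 0 s i) R) (size
  s).
pose P := @dirac _ (borel A) (0 : A) R.
have mE (E : set A) : m E = (\sum_(a <- s) \1_E a)%:E.
  rewrite /m /= /msum (big_nth 0) big_mkord -sumEFin; apply: eq_bigr => i _.
  by rewrite /= diracE indicE.
have s_gt0 : (0 < size s)%N.
  have : 1 \in s by rewrite sG inE.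
  by case: (s).
have sz0 : (size s)%:R != 0 :> R by rewrite pnatr_eq0 -lt0n.
have mG (E : set A) : G `<=` E -> m E = (size s)%:R%:E.
  move=> GsubE; rewrite mE; congr (_%:E); rewrite -sum1_size natr_sum.
  rewrite [LHS]big_seq [RHS]big_seq; apply: eq_bigr => a;
    rewrite sG inE => /GsubE Ea.
  by rewrite indicE mem_set.
have nE (E : set A) : mnormalize m P E = (m E * ((size s)%:R^-1)%:E)%E.
  by apply: mnormalize_fin sz0; exact: mG.
exists (@mnormalize _ (borel A) R m P); split.
  by apply: etrans (nE G) _; rewrite mG // -EFinM divff.
move=> g E Gg mEE EG; apply: etrans (nE _) (etrans _ (esym (nE E))).
congr (_ * _)%E; rewrite !mE; congr (_%:E).
have gg := mul_star_comm (GU _ Gg).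
have gK : cancel ( *%R (star g)) ( *%R g).
  by move=> a; rewrite mulrA (GU _ Gg) mul1r.
have perm : perm_eq s (map ( *%R g) s).
  apply: uniq_perm; first exact: undup_uniq.
    rewrite map_inj_uniq ?undup_uniq // => a b /(congr1 ( *%R (star g))).
    by rewrite !mulrA gg !mul1r.
  move=> a; apply/idP/mapP => [|[b bs ->]].
    rewrite sG inE => Ga; exists (star g * a); last by rewrite gK.
    by rewrite sG inE; apply: GM => //; exact: GS.
  by move: bs; rewrite !sG !inE => Gb; exact: GM.
rewrite (perm_big _ perm) big_map; apply: eq_bigr => a _ /=.
rewrite !indicE; congr (_%:R); congr nat_of_bool; apply/idP/idP; rewrite !inE.
  by move=> [b Eb /(congr1 ( *%R (star g)))]; rewrite !mulrA gg !mul1r => <-.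
by move=> Ea; exists a.
Qed.

(** * Matrix units *)

Section MatrixUnits.
Variables (R : rcfType) (k : divalg_kind) (n : nat).
Local Notation D := (divalg R k).
Local Notation M := (starmx D n).
Local Notation U := (divalg_units R k).
Local Notation SU := (divalg_sunits R k).
Implicit Types (x y : M) (p q : 'I_n) (u v : D).

Definition munit p q u : M := \matrix_(i, l) (if (i == p) && (l ==
  q) then u else 0).

Lemma munitE p q u i l : munit p q u i l = if (i == p) && (l ==
  q) then u else 0.
Proof. by rewrite mxE. Qed.

Lemma mulmxE x y i l : (x * y) i l = \sum_j x i j * y j l.
Proof. by rewrite mxE. Qed.

Lemma addmxE x y i l : (x + y) i l = x i l + y i l.
Proof. by rewrite mxE. Qed.

Lemma oppmxE x i l : (- x) i l = - x i l.
Proof. by rewrite mxE. Qed.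

Lemma scalemxE c x i l : (c *: x) i l = c *: x i l.
Proof. by rewrite mxE. Qed.

Lemma onemxE i l : (1 : M) i l = if i == l then 1 else 0.
Proof. by rewrite mxE; case: eqP. Qed.

Lemma starmxE x i l : (star x) i l = star (x l i).
Proof. by rewrite !mxE. Qed.

Lemma sum_starmxE (I : Type) (r : seq I) (P : pred I) (F : I -> M) i l :
  (\sum_(j <- r | P j) F j) i l = \sum_(j <- r | P j) F j i l.
Proof. exact: summxE. Qed.

Lemma munit_mull p q u x i l :
  (munit p q u * x) i l = if i == p then u * x q l else 0.
Proof.
rewrite mulmxE (bigD1 q) //= munitE eqxx andbT big1 ?addr0 => [|j jq].
  by case: eqP; rewrite ?mul0r.
by rewrite munitE (negbTE jq) andbF mul0r.
Qed.

Lemma munit_mulr p q u x i l :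
  (x * munit p q u) i l = if l == q then x i p * u else 0.
Proof.
rewrite mulmxE (bigD1 p) //= munitE eqxx big1 ?addr0 => [|j jp].
  by case: eqP; rewrite ?mulr0.
by rewrite munitE (negbTE jp) mulr0.
Qed.

Lemma munit_star p q u : star (munit p q u) = munit q p (star u).
Proof.
apply/matrixP => i l; rewrite starmxE !munitE andbC.
by case: ifP => // _; rewrite linear0.
Qed.

Lemma munit_sandwich_entry p q u x :
  munit p q u * x * munit p q u = munit p q (u * x q p * u).
Proof.
apply/matrixP => i l; rewrite munit_mulr munit_mull munitE andbC.
by case: eqP => //= _; case: eqP => // _; rewrite mul0r.
Qed.

Lemma munit_linear p q : linear (munit p q).
Proof.
move=> c u v; apply/matrixP => i l; rewrite addmxE scalemxE !munitE.
by case: ifP => // _; rewrite scaler0 addr0.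
Qed.
HB.instance Definition _ p q :=
  GRing.isLinear.Build R D M *:%R (munit p q) (munit_linear p q).

Lemma munit_decomposition x : x = \sum_p \sum_q munit p q (x p q).
Proof.
apply/matrixP => i l; rewrite sum_starmxE (bigD1 i) //= sum_starmxE (bigD1 l)
  //=.
rewrite munitE !eqxx /= !big1 ?addr0 // => [p pi|q ql].
  by rewrite sum_starmxE big1 // => q _; rewrite munitE eq_sym (negbTE pi).
by rewrite munitE eqxx eq_sym (negbTE ql).
Qed.

Lemma munit_expansion x :
  x = \sum_p \sum_q \sum_(u <- U) divalg_re (x p q * star u) *: munit p q u.
Proof.
rewrite {1}(munit_decomposition x); apply: eq_bigr => p _;
  apply: eq_bigr => q _.
rewrite {1}(divalg_expansion (x p q)) linear_sum; apply: eq_bigr => u _.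
by rewrite linearZ.
Qed.

(** A sandwich over an orthonormal basis returns the adjoint, with the factor
    that distinguishes the three division algebras. *)
Lemma munit_sandwich x :
  \sum_p \sum_q \sum_(u <- U) munit p q u * x * munit p q u =
    (2 - (\dim {: D})%:R) *: star x.
Proof.
rewrite (munit_decomposition (star x)) scaler_sumr; apply: eq_bigr => p _.
rewrite scaler_sumr; apply: eq_bigr => q _.
under eq_bigr => u _ do rewrite munit_sandwich_entry.
by rewrite -linear_sum divalg_units_sandwich linearZ starmxE.
Qed.

Lemma munit_norm :
  \sum_p \sum_q \sum_(u <- U) munit p q u * star (munit p q u) =
    (n%:R * (\dim {: D})%:R : R) *: (1 : M).
Proof.
have uu p q u : u \in U -> munit p q u * star (munit p q u) = munit p p 1.
  move=> uU; apply/matrixP => i l; rewrite munit_star munit_mulr munitE eqxx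
    andbT.
  rewrite munitE andbC; case: eqP => // _; case: eqP => _ //=;
    last by rewrite mul0r.
  by case: (divalg_unitV uU) => [[]|[]].
have one_dec : (1 : M) = \sum_p munit p p 1.
  rewrite [LHS]munit_decomposition; apply: eq_bigr => p _.
  rewrite (bigD1 p) //= onemxE eqxx big1 ?addr0 // => q qp.
  by rewrite onemxE eq_sym (negbTE qp) linear0.
rewrite one_dec scaler_sumr; apply: eq_bigr => p _.
have sumU q : \sum_(u <- U) munit p q u * star (munit p q u) =
    munit p p 1 *+ \dim {: D}.
  rewrite big_seq (eq_bigr (fun=> munit p p 1)); last by move=> u; exact: uu.
  by rewrite -big_seq big_const_seq count_predT iter_addr_0 size_divalg_units.
under eq_bigr => q _ do rewrite sumU.
by rewrite sumr_const card_ord -mulrnA -scaler_nat mulnC natrM.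
Qed.

Lemma unitary_coef_bound x p q u : x * star x = 1 -> u \in U ->
  `|divalg_re (x p q * star u)| <= 1.
Proof.
move=> xx uU; have : divalg_re ((x * star x) p p) = 1.
  by rewrite xx onemxE eqxx divalg_re1.
rewrite mulmxE linear_sum (bigD1 q) //= starmxE divalg_parseval => h.
have : divalg_re (x p q * star u) ^+ 2 <= 1.
  rewrite -[leRHS]h; set S := (X in _ + X); have S0 : 0 <= S.
    apply: sumr_ge0 => j _; rewrite starmxE divalg_parseval.
    by apply: sumr_ge0 => v _; exact: sqr_ge0.
  rewrite (big_rem u) //= -addrA lerDl addr_ge0 //.
  by apply: sumr_ge0 => v _; exact: sqr_ge0.
by rewrite -[X in _ <= X](expr1n R 2) -real_normK ?num_real // ler_pXn2r
  ?nnegrE.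
Qed.

(** * Monomial matrices *)

(** Imposed on both [x] and [star x], this makes [x] a permutation matrix up to
    signed units. *)
Definition monomial x : Prop :=
  forall p, exists q, x p q \in SU /\ forall l, l != q -> x p l = 0.

Lemma monomial1 : monomial 1.
Proof.
move=> p; exists p; rewrite onemxE eqxx; split=> [|l lp].
  by apply: sub_sunits; exact: divalg_units1.
by rewrite onemxE eq_sym (negbTE lp).
Qed.

Lemma monomialM x y : monomial x -> monomial y -> monomial (x * y).
Proof.
move=> mx my p; have [q [xq x0]] := mx p; have [l [yl y0]] := my q.
have E i : (x * y) p i = x p q * y q i.
  rewrite mulmxE (bigD1 q) //= big1 ?addr0 // => j jq.
  by rewrite x0 // mul0r.
exists l; rewrite E sunitsM //; split=> // i il.
by rewrite E y0 // mulr0.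
Qed.

Lemma monomialN x : monomial x -> monomial (- x).
Proof.
move=> mx p; have [q [xq x0]] := mx p; exists q; rewrite oppmxE sunitsN;
  split=> // l lq.
by rewrite oppmxE x0 // oppr0.
Qed.

Lemma monomial_entry x p q : monomial x -> x p q \in 0 :: SU.
Proof.
move=> mx; have [l [xl x0]] := mx p; rewrite inE.
by have [->|/x0 ->] := eqVneq q l; rewrite ?xl ?orbT ?eqxx.
Qed.

Lemma monomial_unitary x : monomial x -> monomial (star x) -> x * star x = 1.
Proof.
move=> mx msx; apply/matrixP => i l; rewrite mulmxE onemxE.
have [q [xq x0]] := mx i; rewrite (bigD1 q) //= big1 ?addr0; last first.
  by move=> j jq; rewrite x0 // mul0r.
rewrite starmxE; case: eqVneq => [<-|il]; first exact: sunitsV.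
suff -> : x l q = 0 by rewrite linear0 mulr0.
have [j [sj s0]] := msx q; have [li|lj] := eqVneq l j; last first.
  by have := s0 l lj; rewrite starmxE => /(congr1 star); rewrite starK linear0.
have := s0 i; rewrite -li starmxE => /(_ il) /(congr1 star).
rewrite starK linear0 => xq0.
by have := sunits_neq0 xq; rewrite xq0 eqxx.
Qed.

Definition diag_unit p u : M := 1 - munit p p 1 + munit p p u.

Lemma diag_unit_star p u : star (diag_unit p u) = diag_unit p (star u).
Proof. by rewrite /diag_unit linearD linearB /= !munit_star !star1. Qed.

Lemma monomial_diag p u : u \in SU -> monomial (diag_unit p u).
Proof.
move=> uS i; exists i; rewrite /diag_unit !(addmxE, oppmxE, munitE,
  onemxE) eqxx andbb.
split; first case: eqP => _; rewrite ?subrr ?add0r // ?subr0 ?addr0.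
  by apply: sub_sunits; exact: divalg_units1.
move=> l li; rewrite !(addmxE, oppmxE, munitE, onemxE) eq_sym (negbTE li).
have -> : (i == p) && (l == p) = false.
  by apply/negP => /andP [/eqP ip /eqP lp]; rewrite ip lp eqxx in li.
by rewrite subrr addr0.
Qed.

Definition swap_mx p q : M := \matrix_(i, l) (if l ==
  tperm p q i then 1 else 0).

Lemma swap_mx_star p q : star (swap_mx p q) = swap_mx p q.
Proof.
apply/matrixP => i l; rewrite starmxE !mxE.
rewrite -(inj_eq (@perm_inj _ (tperm p q))) tpermK eq_sym.
by case: ifP => _; rewrite ?star1 ?linear0.
Qed.

Lemma monomial_swap p q : monomial (swap_mx p q).
Proof.
move=> i; exists (tperm p q i); rewrite mxE eqxx; split=> [|l /negbTE li].
  by apply: sub_sunits; exact: divalg_units1.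
by rewrite mxE li.
Qed.

(** [diag_unit] rescales the corner [munit p p 1], and [swap_mx] moves it to
    the column [q]. *)
Lemma munit_monomial p q u :
  munit p q u = munit p p 1 * diag_unit p u * swap_mx p q.
Proof.
have -> : munit p p 1 * diag_unit p u = munit p p u.
  apply/matrixP => i l; rewrite munit_mull munitE; case: eqP => //= _.
  rewrite mul1r /diag_unit !(addmxE, oppmxE, munitE, onemxE) eqxx /= eq_sym.
  by case: eqP => _; rewrite subrr add0r.
apply/matrixP => i l; rewrite munit_mull munitE mxE tpermL; case: eqP => //= _.
by case: eqP; rewrite ?mulr1 ?mulr0.
Qed.

Lemma munit_corner p : 1 - diag_unit p (- 1) = 2 *: munit p p 1.
Proof.
rewrite /diag_unit linearN /= !opprD !opprK !addrA subrr add0r.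
by rewrite -mulr2n scaler_nat.
Qed.

End MatrixUnits.

(** * Sums of matrix algebras *)

Section SummandEmbedding.
Variables (R : realType) (N : nat) (D : 'I_N -> divalg_kind) (n : 'I_N -> nat).
Local Notation summand j := (starmx (divalg R (D j)) (n j)).
Local Notation B := (matrix_sum R D n).
Implicit Types (x y : B) (j : 'I_N).

HB.instance Definition _ j := GRing.isLinear.Build R B (summand j) *:%R
  (@component R N D n j) (component_linear j).

Definition embed j (X : summand j) : B :=
  of_components (eqtype.dfwith (fun i => 0 : summand i) X).

Lemma embed_in j (X : summand j) : component j (embed X) = X.
Proof. by rewrite of_componentsK dfwith_in. Qed.

Lemma embed_out j (X : summand j) i : j != i -> component i (embed X) = 0.
Proof. by move=> ji; rewrite of_componentsK dfwith_out. Qed.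

Lemma embed_linear j : linear (@embed j).
Proof.
move=> c X Y; apply: componentP => i; rewrite linearP /=.
have [<-|ji] := eqVneq j i; first by rewrite !embed_in.
by rewrite !embed_out // scaler0 addr0.
Qed.
HB.instance Definition _ j := GRing.isLinear.Build R (summand j) B *:%R
  (@embed j) (embed_linear (j:=j)).

Lemma embedMr j (X : summand j) x : embed X * x = embed (X * component j x).
Proof.
apply: componentP => i; rewrite componentM.
have [<-|ji] := eqVneq j i; first by rewrite !embed_in.
by rewrite !embed_out // mul0r.
Qed.

Lemma embedMl j (X : summand j) x : x * embed X = embed (component j x * X).
Proof.
apply: componentP => i; rewrite componentM.
have [<-|ji] := eqVneq j i; first by rewrite !embed_in.
by rewrite !embed_out // mulr0.
Qed.

Lemma embed_star j (X : summand j) : star (embed X) = embed (star X).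
Proof.
apply: componentP => i; rewrite componentS.
have [<-|ji] := eqVneq j i; first by rewrite !embed_in.
by rewrite !embed_out // linear0.
Qed.

Lemma component_sum (I : Type) (r : seq I) (F : I -> B) j :
  component j (\sum_(i <- r) F i) = \sum_(i <- r) component j (F i).
Proof. exact: linear_sum. Qed.

Lemma embed_decomposition x : x = \sum_j embed (component j x).
Proof.
apply: componentP => i; rewrite component_sum (bigD1 i) //= embed_in.
by rewrite big1 ?addr0 // => j ji; rewrite embed_out.
Qed.

(** The condition on the adjoint gives closure under [star]. *)
Definition monomial_group : set B := [set x | forall j,
  monomial (component j x) /\ monomial (star (component j x))].

Lemma monomial_group1 : monomial_group 1.
Proof. by move=> j; rewrite component1 star1; split; exact: monomial1. Qed.

Lemma monomial_groupN1 : monomial_group (- 1).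
Proof.
move=> j; rewrite [component j _]linearN /= component1 [star _]linearN /= star1.
by split; apply: monomialN; exact: monomial1.
Qed.

Lemma monomial_groupM x y :
  monomial_group x -> monomial_group y -> monomial_group (x * y).
Proof.
move=> mx my j; have [x1 x2] := mx j; have [y1 y2] := my j.
by rewrite componentM starM; split; exact: monomialM.
Qed.

Lemma monomial_groupS x : monomial_group x -> monomial_group (star x).
Proof. by move=> mx j; have [x1 x2] := mx j; rewrite componentS starK. Qed.

Lemma monomial_group_unitary x : monomial_group x -> x * star x = 1.
Proof.
move=> mx; apply: componentP => j; rewrite componentM componentS component1.
by have [] := mx j; exact: monomial_unitary.
Qed.

Lemma monomial_group_finite : finite_set monomial_group.
Proof.
(* There are at most eight signed units; index 0 codes the zero entry. *)
pose T := {dffun forall j : 'I_N, {ffun 'I_(n j) * 'I_(n j) -> 'I_9}}.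
pose dec (t : T) : B := of_components (fun j => (\matrix_(p, q)
  nth 0 (0 :: divalg_sunits R (D j)) (t j (p, q))) : summand j).
apply: (@sub_finite_set _ _ (dec @` [set: T])); last first.
  exact/finite_image/finite_finset.
move=> x mx; pose L j := 0 :: divalg_sunits R (D j).
have sL j : (size (L j) <= 9)%N by rewrite /L; case: (D j).
pose t : T := @finfun _ (fun j => {ffun 'I_(n j) * 'I_(n j) -> 'I_9})
  (fun j => [ffun pq => inord (index (component j x pq.1 pq.2) (L j))]).
exists t => //; apply: componentP => j; rewrite of_componentsK.
have xL p q : component j x p q \in L j.
  by apply: monomial_entry; have [] := mx j.
have lt9 p q : (index (component j x p q) (L j) < 9)%N.
  by apply: leq_trans (sL j); rewrite index_mem.
apply/matrixP => p q; rewrite mxE !ffunE inordK; first exact: nth_index.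
exact: lt9.
Qed.

(** Replacing one component of the unit stays in the group; differences and
    products of such elements give all matrix units. *)
Lemma monomial_group_generates : generates monomial_group.
Proof.
move=> C [C1 Clin CM CS] GC; apply/seteqP; split=> // x _.
have C0 : C 0 by rewrite -(subrr 1) addrC -scaleN1r; exact: Clin.
have CZ c y : C y -> C (c *: y) by move=> Cy; rewrite -[_ *: _]addr0;
  exact: Clin.
have Csum (I : Type) (r : seq I) (F : I -> B) : (forall i,
  C (F i)) -> C (\sum_(i <- r) F i).
  move=> CF; elim/big_ind: _ => // y z Cy Cz.
  by rewrite -[y]scale1r; exact: Clin.
pose repl j (X : summand j) : B := 1 + embed (X - 1).
have replE j (X : summand j) i : component i (repl j X) =
    eqtype.dfwith (fun i => 1 : summand i) X i.
  rewrite /repl [component i _]linearD /= component1;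
    have [<-|ji] := eqVneq j i.
    by rewrite embed_in dfwith_in addrC subrK.
  by rewrite embed_out // dfwith_out // addr0.
have Crepl j (X : summand j) : monomial X -> monomial (star X) -> C (repl j X).
  move=> mX mSX; apply: GC => i; rewrite replE; have [<-|ji] := eqVneq j i.
    by rewrite dfwith_in.
  by rewrite dfwith_out // star1; split; exact: monomial1.
have mulrepl j (X Y : summand j) : embed X * repl j Y = embed (X * Y).
  by rewrite embedMr replE dfwith_in.
have unitN1 j : (- 1 : divalg R (D j)) \in divalg_sunits R (D j).
  by rewrite sunitsN; apply: sub_sunits; exact: divalg_units1.
have Cdiag j p u : u \in divalg_sunits R (D j) -> C (repl j (diag_unit p u)).
  move=> uS; apply: Crepl; rewrite ?diag_unit_star; apply: monomial_diag => //.
  exact: sunits_star.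
have Ccorner j p : C (embed (munit p p 1 : summand j)).
  have Cd := Cdiag j p _ (unitN1 j).
  have -> : embed (munit p p 1 : summand j) =
      2^-1 *: (1 - repl j (diag_unit p (- 1))).
    rewrite /repl opprD addrA subrr add0r -[- embed _]linearN /= opprB
      munit_corner.
    by rewrite [embed (_ *: _)]linearZ /= scalerA mulVf ?scale1r // pnatr_eq0.
  by apply: CZ; rewrite addrC -scaleN1r; exact: Clin.
have Cunit j p q u : u \in divalg_units R (D j) -> C (embed (munit p q u :
  summand j)).
  move=> uU; rewrite munit_monomial -!mulrepl; have uS := sub_sunits uU.
  apply: CM _ _ (CM _ _ (Ccorner j p) (Cdiag j p u uS)) _.
  by apply: Crepl; rewrite ?swap_mx_star; exact: monomial_swap.
rewrite (embed_decomposition x); apply: (Csum) => j.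
rewrite (munit_expansion (component j x)) linear_sum; apply: (Csum) => p.
rewrite linear_sum; apply: (Csum) => q; rewrite linear_sum big_seq.
elim/big_ind: _ => // [y z Cy Cz|u uU]; first by rewrite -[y]scale1r;
  exact: Clin.
by rewrite linearZ; apply: CZ; exact: Cunit.
Qed.

End SummandEmbedding.

(** * Transport along an isomorphism *)

Section Transport.
Variables (R : realType) (A : starAlgType R).
Variables (N : nat) (D : 'I_N -> divalg_kind) (n : 'I_N -> nat).
Local Notation summand j := (starmx (divalg R (D j)) (n j)).
Local Notation B := (matrix_sum R D n).
Local Notation delta j := (\dim {: divalg R (D j)})%:R.
Variable phi : {linear B -> A}.
Hypothesis n_gt0 : forall j, (0 < n j)%N.
Hypothesis phi1 : phi 1 = 1.
Hypothesis phiM : {morph phi : x y / x * y}.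
Hypothesis phiS : {morph phi : x / star x}.
Hypothesis phi_bij : bijective phi.

Lemma phi_onto a : exists b, phi b = a.
Proof. by have [g _ gK] := phi_bij; exists (g a). Qed.

Local Notation G0 := (phi @` @monomial_group R N D n).

Lemma image_generates : generates G0.
Proof.
move=> C [C1 Clin CM CS] GC.
have : phi @^-1` C = [set: B].
  apply: (@monomial_group_generates R N D n); last by move=> x mx; apply: GC;
    exists x.
  split; rewrite /preimage /=; first by rewrite phi1.
  - by move=> k x y Cx Cy; rewrite linearP; exact: Clin.
  - by move=> x y Cx Cy; rewrite phiM; exact: CM.
  - by move=> x Cx; rewrite phiS; exact: CS.
move=> CT; apply/seteqP; split=> // a _; have [b <-] := phi_onto a.
by have : (phi @^-1` C) b by rewrite CT.
Qed.

Lemma image_unitary_subgroup : unitary_subgroup G0.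
Proof.
split.
- move=> _ [x mx <-]; rewrite /unitary_group /= -phiS -phiM.
  by rewrite monomial_group_unitary ?phi1.
- by exists 1; [exact: monomial_group1|rewrite phi1].
- move=> _ _ [x mx <-] [y my <-]; exists (x * y); last by rewrite phiM.
  exact: monomial_groupM.
- move=> _ [x mx <-]; exists (star x); last by rewrite phiS.
  exact: monomial_groupS.
Qed.

(** The mean of the finite monomial group vanishes because it contains
    [- 1]. *)
Lemma polarizing_exists : exists G (mu : probability (borel A) R),
  polarizing G /\ is_haar G mu.
Proof.
have finG : finite_set G0 by apply: finite_image; exact: monomial_group_finite.
have sG := image_unitary_subgroup.
have cG : compact (G0 : set (natural A)) by exact: finite_compact.
have [mu hmu] := finite_haar sG finG.
exists G0, mu; split=> //; split=> //; first exact: image_generates.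
exists mu => //; have cid := @ccontinuous_id _ A.
have GN1 : G0 (- 1).
  by exists (- 1); [exact: monomial_groupN1|rewrite linearN /= phi1].
have := vint_translate cG hmu sG cid GN1.
rewrite vintMl // mulN1r => /eqP; rewrite -subr_eq0 -opprD oppr_eq0 -mulr2n.
by rewrite -scaler_nat scaler_eq0 pnatr_eq0 /= => /eqP.
Qed.

(** In an expansion along matrix units the coordinates of a unitary element are
    at most one in absolute value. *)
Lemma unitary_coord_bounded i : exists M : R,
  forall a : A, unitary_group a -> `|v2r a 0 i| <= M.
Proof.
exists (\sum_j \sum_p \sum_q \sum_(u <- divalg_units R (D j))
  `|v2r (phi (embed (munit p q u : summand j))) 0 i|).
move=> a; have [b <-] := phi_onto a; rewrite /unitary_group /= => ub.
have bb j : component j b * star (component j b) = 1.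
  rewrite -componentS -componentM -[b * star b](_ : 1 = _) ?component1 //.
  by apply: (bij_inj phi_bij); rewrite phi1 phiM phiS.
rewrite {1}(embed_decomposition b) !linear_sum summxE.
apply: le_trans (ler_norm_sum _ _ _) _; apply: ler_sum => j _.
rewrite {1}(munit_expansion (component j b)) !linear_sum summxE.
apply: le_trans (ler_norm_sum _ _ _) _; apply: ler_sum => p _.
rewrite !linear_sum summxE.
apply: le_trans (ler_norm_sum _ _ _) _; apply: ler_sum => q _.
rewrite !linear_sum summxE.
apply: le_trans (ler_norm_sum _ _ _) _.
rewrite big_seq [leRHS]big_seq; apply: ler_sum => u uU.
rewrite !linearZ /= mxE normrM ler_piMl //.
exact: unitary_coef_bound (bb j) uU.
Qed.

(** The group is closed, as the fibre of [u * star u] over 1, and bounded in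
    coordinates. *)
Lemma unitary_compact : compact (@unitary_group R A : set (natural A)).
Proof.
pose U := (@unitary_group R A : set (natural A)).
have closedU : closed U.
  have -> : U = \bigcap_i ((fun u : natural A => v2r ((u : A) * star (u :
    A)) 0 i)
      @^-1` [set v2r (1 : A) 0 i]).
    apply/seteqP; split=> u; first by move=> uu i _ /=; rewrite (uu : _ = _).
    move=> h; apply: (can_inj v2rK); apply/rowP => i; exact: (h i I).
  apply: closed_bigI => i _; apply: preimage_closed; last exact: closed_eq.
  have cc : ccontinuous (fun u : A => u * star u).
    apply: ccontinuousM; first exact: ccontinuous_id.
    exact: (@ccontinuous_linear _ _ id (@star R A)) (@ccontinuous_id _ A).
  by move=> u _; exact: cc.
have r2v_cont : continuous (r2v : 'rV[R]_(dim A) -> natural A).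
  apply: continuous_comp_initial.
  have -> : (v2r \o (r2v : 'rV[R]_(dim A) -> natural A)) =
    id by apply/funext => v /=; rewrite r2vK.
  by move=> v; exact: cvg_id.
rewrite -/U; have -> : U = r2v @` ((r2v : 'rV[R]_(dim A) -> natural A) @^-1` U).
  apply/seteqP; split=> u; last by move=> [v Uv <-].
  by move=> Uu; exists (v2r u); rewrite /= v2rK.
apply: (@continuous_compact 'rV[R]_(dim A) (natural A)).
  exact: continuous_subspaceT.
apply: bounded_closed_compact; last first.
  by apply: preimage_closed => // v _; exact: r2v_cont.
have [M MP] := choice unitary_coord_bounded.
exists (\sum_i `|M i|); split; first exact: num_real.
move=> K MK v /= Uv; have vM i := MP i _ Uv; rewrite /Num.norm /= mx_normrE.
have K0 : 0 <= K by apply: le_trans (ltW MK); apply: sumr_ge0 => i _.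
apply/bigmax_leP; split=> // [[i j] _] /=; rewrite ord1 -[v]r2vK.
apply: le_trans (vM j) (le_trans (ler_norm _) (le_trans _ (ltW MK))).
by rewrite (bigD1 j) //= lerDl; apply: sumr_ge0 => k _.
Qed.

Definition summand_unit j : A := phi (embed (1 : summand j)).

Lemma summand_unitE j x : summand_unit j * phi x = phi (embed (component j x)).
Proof. by rewrite -phiM embedMr mul1r. Qed.

Lemma summand_unit_sum : \sum_j summand_unit j = 1.
Proof.
rewrite -linear_sum -phi1 [in RHS](embed_decomposition 1); congr (phi _).
by apply: eq_bigr => j _; rewrite component1.
Qed.

Section Average.
Variables (G : set A) (mu : probability (borel A) R).
Hypothesis hG : polarizing G.
Hypothesis hmu : is_haar G mu.
Local Notation c := (sandwich G mu 1).

(** Both sides are the sum over the matrix units [E] of the integrals of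
    [E * g * E * g]: [sandwichE] evaluates each integral, and [munit_sandwich]
    sums the integrands. *)
Lemma sandwich_unit j :
  ((n j)%:R * delta j : R) *: (summand_unit j * c) = (2 - delta j) *:
    summand_unit j.
Proof.
have [sG cG _ _] := hG; have [GU _ _ _] := sG.
pose e p q u := phi (embed (munit p q u : summand j)).
transitivity (\sum_p \sum_q \sum_(u <- divalg_units R (D j))
    vintegral mu G (fun g => e p q u * (g * e p q u * g))).
  rewrite stalgAl -linearZ -linearZ /= -munit_norm.
  rewrite linear_sum linear_sum mulr_suml; apply: eq_bigr => p _.
  rewrite linear_sum linear_sum mulr_suml; apply: eq_bigr => q _.
  rewrite linear_sum linear_sum mulr_suml; apply: eq_bigr => u _.
  rewrite vintMl; [|exact: cG|exact: sandwich_ccontinuous].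
  rewrite -/(sandwich G mu (e p q u)) (sandwichE hG hmu (e p q u)) mulrA /e
    -phiS -phiM.
  by rewrite embed_star embedMr embed_in.
have ce p q u : ccontinuous (fun g : A => e p q u * (g * e p q u * g)).
  by apply: ccontinuousM; [exact: ccontinuous_cst|exact: sandwich_ccontinuous].
have csum q p (r := divalg_units R (D j)) :
    ccontinuous (fun g : A => \sum_(u <- r) e p q u * (g * e p q u * g)).
  by apply: ccontinuous_sum => u.
transitivity (vintegral mu G (fun g => \sum_p \sum_q \sum_(u <- divalg_units R
  (D j))
    e p q u * (g * e p q u * g))).
  rewrite vint_sum // => [|p]; last by apply: ccontinuous_sum => q.
  apply: eq_bigr => p _; rewrite vint_sum //; apply: eq_bigr => q _.
  by rewrite vint_sum.
rewrite -[RHS](vint_cst cG hmu); apply: eq_vint => g Gg.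
have [b gE] := phi_onto g; have gg := mul_star_comm (GU _ Gg).
transitivity (phi (embed ((2 - delta j) *: star (component j b))) * g).
  rewrite -munit_sandwich !linear_sum mulr_suml; apply: eq_bigr => p _.
  rewrite !linear_sum mulr_suml; apply: eq_bigr => q _.
  rewrite !linear_sum mulr_suml; apply: eq_bigr => u _.
  by rewrite /e -gE !mulrA -!phiM embedMr embedMr embed_in.
rewrite !linearZ /= -stalgAl -componentS -summand_unitE phiS gE -mulrA gg.
by rewrite mulr1.
Qed.

Definition polarization_coef j : R :=
  (n j)%:R * delta j / (((n j)%:R - 1) * delta j + 2).

Lemma polarization_elementE :
  phi (polarization_element R D n) =
    \sum_j polarization_coef j *: summand_unit j.
Proof.
rewrite [X in phi X]embed_decomposition linear_sum; apply: eq_bigr => j _.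
rewrite /component mkdsumE -/(polarization_coef j) /summand_unit.
by rewrite -linearZ -linearZ.
Qed.

Lemma polarization_elementC a :
  a * phi (polarization_element R D n) = phi (polarization_element R D n) * a.
Proof.
have [b <-] := phi_onto a; rewrite -!phiM; congr (phi _);
  apply: componentP => j.
rewrite !componentM [component j (polarization_element _ _ _)]mkdsumE.
rewrite -[X in _ = X](stalgAl _ (1 : summand j)) -[X in X = _](stalgAr _ _ (1 :
  summand j)).
by rewrite mulr1 mul1r.
Qed.

(** The denominator of the constant is [1 + (2 - delta) / (n * delta)] times
    [n * delta]. *)
Lemma polarization_elementV : phi (polarization_element R D n) * (1 + c) = 1.
Proof.
rewrite polarization_elementE mulr_suml -[RHS]summand_unit_sum;
  apply: eq_bigr => j _.
have d_gt0 : (0 : R) < delta j by rewrite ltr0n dim_divalg; case: (D j).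
have nj_ge1 : (1 : R) <= (n j)%:R by rewrite ler1n.
have nd_neq0 : (n j)%:R * delta j != 0 :> R by rewrite mulf_neq0 ?gt_eqF //
  (lt_le_trans _ nj_ge1).
have den_gt0 : (0 : R) < ((n j)%:R - 1) * delta j + 2.
  by rewrite ltr_wpDl // mulr_ge0 ?subr_ge0 // ltW.
have := sandwich_unit j; move=> /(congr1 ( *:%R ((n j)%:R * delta j)^-1)).
rewrite !scalerA mulVf // scale1r => zc.
rewrite -stalgAl mulrDr mulr1 zc -[X in X + _]scale1r -scalerDl scalerA.
rewrite /polarization_coef -[RHS]scale1r; congr (_ *: _).
have nn0 : (n j)%:R != 0 :> R by rewrite gt_eqF // (lt_le_trans _ nj_ge1).
have d0 := lt0r_neq0 d_gt0; have den0 := lt0r_neq0 den_gt0.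
by field; rewrite nn0 d0 den0.
Qed.

End Average.

(** For the form [x * star y] at [x = y = 1], the defining identity reads
    [1 = kappa * (1 + sandwich 1)]. *)
Lemma polarization_constant_unique kappa :
  is_polarization_constant kappa <-> kappa = phi (polarization_element R D n).
Proof.
split=> [hk|-> X Q G mu hQ hG hmu x y]; last first.
  rewrite (polarization_integral hG hmu) // mulrA -polarization_elementC -mulrA.
  by rewrite (polarization_elementV hG hmu) mulr1.
have [G [mu [hG hmu]]] := polarizing_exists.
have hQ : @hermitian_form R A (A^o) (fun x y => (x : A) * star (y : A)).
  split; first by move=> x1 x2 y; rewrite mulrDl.
    by move=> a x y; rewrite -mulrA.
  by move=> x y; rewrite starM starK.
pose one : A^o := (1 : A).
have := etrans (hk _ _ G mu hQ hG hmu one one)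
  (congr1 ( *%R kappa) (polarization_integral hG hmu one one hQ)).
rewrite /one star1 !mul1r => h1.
have kc := polarization_elementV hG hmu.
rewrite -[LHS]mulr1 -kc -polarization_elementC mulrA -h1 mul1r.
by [].
Qed.

End Transport.

Lemma star_isomorphism_bundle (R : realType) (A B : starAlgType R) (phi :
  B -> A) :
  star_isomorphism phi -> exists f : {linear B -> A},
    [/\ phi = f, f 1 = 1, {morph f : x y / x * y}, {morph f : x / star x} &
        bijective f].
Proof.
by move=> [/linear_bundle [f ->] f1 fM fS fb]; exists f.
Qed.

Theorem theorem1p2 (R : realType) (A : starAlgType R) :
  (polarizable A <->
    exists (N : nat) (D : 'I_N -> divalg_kind) (n : 'I_N -> nat)
           (phi : matrix_sum R D n -> A),
      (forall j, (0 < n j)%N) /\ star_isomorphism phi)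
  /\
  (forall (N : nat) (D : 'I_N -> divalg_kind) (n : 'I_N -> nat)
          (phi : matrix_sum R D n -> A),
      (forall j, (0 < n j)%N) -> star_isomorphism phi ->
      forall kappa : A,
        is_polarization_constant kappa <->
        kappa = phi (polarization_element R D n)).
Proof.
split.
  split=> [/positive_functional_exists [tau]|]; first exact: positive_structure.
  move=> [N [D [n [phi [_ /star_isomorphism_bundle [f [_ f1 fM fS fb]]]]]]].
  split; first exact: (unitary_compact f1 fM fS fb).
  move=> C hC UC; apply: (image_generates f1 fM fS fb hC) => u Gu; apply: UC.
  by have [GU _ _ _] := image_unitary_subgroup f1 fM fS; exact: GU.
move=> N D n phi n0 /star_isomorphism_bundle [f [-> f1 fM fS fb]] kappa.
exact: polarization_constant_unique.
Qed.
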